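(* Let $p$ be a prime, let $n\in\mathbb{N}$, $n\ge1$, and let $T\in GL(n,\mathbb{Q}_p)$. Let $\overline{T}:\mathcal{S}_n\to\mathcal{S}_n$ be given by $\overline{T}(x)=\|T(x)\|_p\,T(x)$, and for $a\in\mathbb{Q}_p^n\setminus\{0\}$ with $\|T^{-1}(a)\|_p<1$ let $\overline{T}_a:\mathcal{S}_n\to\mathcal{S}_n$ be given by $\overline{T}_a(x)=\|a+T(x)\|_p\,(a+T(x))$. Then $\overline{T}$ is distal if and only if there exists a neighbourhood $V$ of $0$ in $\mathbb{Q}_p^n$ such that for every $a\in V\setminus\{0\}$, $\|T^{-1}(a)\|_p<1$ and $\overline{T}_a$ on $\mathcal{S}_n$ is distal.
   Context: Here $|\cdot|_p$ is the $p$-adic absolute value on $\mathbb{Q}_p$, and for $x=(x_1,\dots,x_n)\in\mathbb{Q}_p^n$, $\|x\|_p=\max_{1\le i\le n}|x_i|_p$. The $p$-adic unit sphere is $\mathcal{S}_n=\{x\in\mathbb{Q}_p^n\mid\|x\|_p=1\}$. For nonzero $v\in\mathbb{Q}_p^n$, $\|v\|_p$ is an integer power $p^m$ of $p$, and in the expression $\|v\|_p\,v$ this power is regarded as the scalar $p^m\in\mathbb{Q}_p$; thus $\|v\|_p\,v$ has norm $1$. The map $\overline{T}$ is a homeomorphism of $\mathcal{S}_n$, and $\overline{T}_a$ is a homeomorphism of $\mathcal{S}_n$ when $\|T^{-1}(a)\|_p<1$. A homeomorphism $\phi$ of a Hausdorff topological space $X$ is distal if for every pair of distinct $x,y\in X$,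 the closure of $\{(\phi^k(x),\phi^k(y))\mid k\in\mathbb{Z}\}$ in $X\times X$ does not intersect the diagonal $\{(d,d)\mid d\in X\}$. *)

(* Defs.v *)
From HB Require Import structures.
From mathcomp Require Import all_boot all_order all_algebra.
From mathcomp Require Import all_classical all_reals all_analysis.

Set Implicit Arguments.
Unset Strict Implicit.
Unset Printing Implicit Defensive.

Import Order.TTheory GRing.Theory Num.Theory.

Local Open Scope classical_set_scope.
Local Open Scope ring_scope.

(* Z_p is the inverse limit of the rings Z/p^k: a p-adic integer is the
   sequence of its least nonnegative residues modulo p^k. *)
Record padic_int (p : nat) (p_pr : prime p) := PadicInt {
  residue :> nat -> nat;
  _ : `[< forall k, (residue k.+1 %% p ^ k)%N = residue k >] }.

HB.instance Definition _ p (p_pr : prime p) := [isSub for @residue p p_pr].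
HB.instance Definition _ p (p_pr : prime p) :=
  [Choice of padic_int p_pr by <:].

Section PadicIntRing.
Variables (p : nat) (p_pr : prime p).
Local Notation Zp := (padic_int p_pr).
Implicit Types x y z : Zp.

Lemma residueS x k : (x k.+1 %% p ^ k)%N = x k.
Proof. by case: x => f /= /asboolP. Qed.

Lemma residue_mod x k : (x k %% p ^ k)%N = x k.
Proof. by rewrite -residueS modn_mod. Qed.

Lemma residue_le x k l : (k <= l)%N -> (x l %% p ^ k)%N = x k.
Proof.
elim: l => [|l IHl]; first by rewrite leqn0 => /eqP ->; apply: residue_mod.
rewrite leq_eqVlt => /orP[/eqP ->|]; first exact: residue_mod.
rewrite ltnS => kl; rewrite -(IHl kl) -[in RHS]residueS modn_dvdm //.
exact: dvdn_exp2l.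
Qed.

Lemma padic_int_eq x y : (forall k, x k = y k) -> x = y.
Proof. by move=> xy; apply/val_inj/funext. Qed.

Lemma limit_subproof (f : nat -> nat) :
    (forall k, f k.+1 = f k %[mod p ^ k])%N ->
  `[< forall k, ((f k.+1 %% p ^ k.+1) %% p ^ k)%N = (f k %% p ^ k)%N >].
Proof.
by move=> fP; apply/asboolP => k; rewrite modn_dvdm ?dvdn_exp2l.
Qed.

Definition padic_limit f fP : Zp := PadicInt p_pr (@limit_subproof f fP).

Lemma const_subproof (c : nat) : (forall k, c = c %[mod p ^ k])%N.
Proof. by []. Qed.

Lemma add_subproof x y k : (x k.+1 + y k.+1 = x k + y k %[mod p ^ k])%N.
Proof. by rewrite -modnDm !residueS. Qed.

Lemma mul_subproof x y k : (x k.+1 * y k.+1 = x k * y k %[mod p ^ k])%N.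
Proof. by rewrite -modnMm !residueS. Qed.

Lemma residue_lt x k : (x k < p ^ k)%N.
Proof. by rewrite -residue_mod ltn_mod expn_gt0 prime_gt0. Qed.

Lemma opp_subproof x k :
  (p ^ k.+1 - x k.+1 = p ^ k - x k %[mod p ^ k])%N.
Proof.
apply/eqP; rewrite -(eqn_modDr (x k)) subnK ?(ltnW (residue_lt _ _)) //.
rewrite -[in X in (X == _)](residueS x k) modnDmr.
by rewrite subnK ?(ltnW (residue_lt _ _)) // modnn -/(dvdn _ _) dvdn_exp2l.
Qed.

Definition padic0 : Zp := padic_limit (const_subproof 0).
Definition padic1 : Zp := padic_limit (const_subproof 1).
Definition padic_add x y : Zp := padic_limit (add_subproof x y).
Definition padic_mul x y : Zp := padic_limit (mul_subproof x y).
Definition padic_opp x : Zp := padic_limit (opp_subproof x).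

Let addA : associative padic_add.
Proof. by move=> x y z; apply: padic_int_eq => k /=; rewrite modnDml modnDmr addnA. Qed.
Let addC : commutative padic_add.
Proof. by move=> x y; apply: padic_int_eq => k /=; rewrite addnC. Qed.
Let add0 : left_id padic0 padic_add.
Proof. by move=> x; apply: padic_int_eq => k /=; rewrite mod0n residue_mod. Qed.
Let addN : left_inverse padic0 padic_opp padic_add.
Proof.
move=> x; apply: padic_int_eq => k /=.
by rewrite modnDml subnK ?(ltnW (residue_lt _ _)) // modnn mod0n.
Qed.

HB.instance Definition _ := GRing.isZmodule.Build Zp addA addC add0 addN.

Let mulA : associative padic_mul.
Proof. by move=> x y z; apply: padic_int_eq => k /=; rewrite modnMml modnMmr mulnA. Qed.
Let mulC : commutative padic_mul.
Proof. by move=> x y; apply: padic_int_eq => k /=; rewrite mulnC. Qed.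
Let mul1 : left_id padic1 padic_mul.
Proof. by move=> x; apply: padic_int_eq => k /=; rewrite modnMml mul1n residue_mod. Qed.
Let mulD : left_distributive padic_mul padic_add.
Proof.
by move=> x y z; apply: padic_int_eq => k /=; rewrite modnMml modnDm mulnDl.
Qed.
Let one_neq0 : padic1 != 0.
Proof.
apply/eqP => /(congr1 (fun x : Zp => x 1)) /=.
by rewrite mod0n modn_small // expn1 prime_gt1.
Qed.

HB.instance Definition _ :=
  GRing.Zmodule_isComNzRing.Build Zp mulA mulC mul1 mulD one_neq0.

Lemma residue0 k : (0 : Zp) k = 0%N. Proof. exact: mod0n. Qed.
Lemma residue1 k : (1 : Zp) k = (1 %% p ^ k)%N. Proof. by []. Qed.
Lemma residueD x y k : (x + y) k = ((x k + y k) %% p ^ k)%N.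
Proof. by []. Qed.
Lemma residueM x y k : (x * y) k = ((x k * y k) %% p ^ k)%N.
Proof. by []. Qed.
Lemma residueN x k : (- x) k = ((p ^ k - x k) %% p ^ k)%N.
Proof. by []. Qed.

Lemma residue_natr m k : (m%:R : Zp) k = (m %% p ^ k)%N.
Proof.
elim: m => [|m IHm]; first by rewrite residue0 mod0n.
by rewrite -natr1 residueD IHm residue1 modnDm addn1.
Qed.

Let is_unit x := `[< exists y, y * x = 1 >].
Let inv x : Zp := if pselect (exists y, y * x = 1) is left h
  then projT1 (cid h) else x.

Let mulVx : {in is_unit, left_inverse 1 inv *%R}.
Proof.
move=> x /asboolP ux; rewrite /inv; case: pselect => // h.
by case: (cid h).
Qed.
Let unitPx x y : y * x = 1 -> is_unit x.
Proof. by move=> yx; apply/asboolP; exists y. Qed.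
Let inv_out : {in [predC is_unit], inv =1 id}.
Proof. by move=> x /asboolP nux; rewrite /inv; case: pselect. Qed.

HB.instance Definition _ :=
  GRing.ComNzRing_hasMulInverse.Build Zp mulVx unitPx inv_out.

Lemma padic_int_neq0 x : x != 0 -> exists k, x k.+1 != 0%N.
Proof.
move=> x0; apply: contrapT => nx; case/eqP: x0; apply: padic_int_eq => k.
rewrite residue0 -residueS; apply/eqP; apply: contrapT => /negP xk.
by apply: nx; exists k; apply: contra xk => /eqP ->; rewrite mod0n.
Qed.

(* The p-adic valuation: the largest v such that x is 0 modulo p^v. *)
Definition padic_int_val x : nat :=
  if pselect (exists k, x k.+1 != 0%N) is left h then ex_minn h else 0%N.

Lemma padic_int_valP x k : x != 0 ->
  (x k == 0%N) = (k <= padic_int_val x)%N.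
Proof.
move=> /padic_int_neq0 x0; rewrite /padic_int_val; case: pselect => // h.
case: ex_minnP => v xv vmin; apply/idP/idP => [xk|kv].
  rewrite leqNgt; apply: contra xv => vk.
  by rewrite -(residue_le x vk) (eqP xk) mod0n.
case: k kv => [|k kv]; first by have := residue_lt x 0; rewrite expn0 ltnS leqn0.
by apply: contraLR kv => /vmin; rewrite -leqNgt.
Qed.

Lemma residue_val x l : x != 0 -> (padic_int_val x < l)%N ->
  exists2 u, x l = (p ^ padic_int_val x * u)%N & ~~ (p %| u)%N.
Proof.
move=> x0 vl; set v := padic_int_val x in vl *.
have /eqP xv : x v == 0%N by rewrite padic_int_valP.
have /dvdnP[u xlE] : (p ^ v %| x l)%N by rewrite /dvdn (residue_le x (ltnW vl)) xv.
exists u; first by rewrite mulnC.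
apply/negP => /dvdnP[w uE].
have : x v.+1 == 0%N.
  by rewrite -(residue_le x vl) xlE uE -mulnA -expnS modnMl.
by rewrite padic_int_valP // ltnn.
Qed.

Lemma residueM_val x y : x != 0 -> y != 0 ->
  (x * y) (padic_int_val x + padic_int_val y).+1 != 0%N.
Proof.
move=> x0 y0; set l := _.+1.
have [u xE pu] : exists2 u, x l = (p ^ padic_int_val x * u)%N & ~~ (p %| u)%N.
  by apply: residue_val; rewrite // ltnS leq_addr.
have [w yE pw] : exists2 u, y l = (p ^ padic_int_val y * u)%N & ~~ (p %| u)%N.
  by apply: residue_val; rewrite // ltnS leq_addl.
rewrite residueM -/(dvdn _ _) xE yE mulnACA -expnD /l expnS mulnC.
by rewrite dvdn_pmul2l ?expn_gt0 ?prime_gt0 // Euclid_dvdM // negb_or pu.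
Qed.

Let integral x y : x * y = 0 -> (x == 0) || (y == 0).
Proof.
move=> xy; apply/negP => /negP; rewrite negb_or => /andP[x0 y0].
by have := residueM_val x0 y0; rewrite xy residue0.
Qed.

HB.instance Definition _ :=
  GRing.ComUnitRing_isIntegral.Build Zp integral.

Lemma padic_int_valM x y : x != 0 -> y != 0 ->
  padic_int_val (x * y) = (padic_int_val x + padic_int_val y)%N.
Proof.
move=> x0 y0; have xy0 : x * y != 0 by rewrite mulf_neq0.
apply/eqP; rewrite eqn_leq leqNgt -padic_int_valP // residueM_val //=.
rewrite -padic_int_valP // residueM -/(dvdn _ _) expnD dvdn_mul //.
  rewrite /dvdn (residue_le x) ?leq_addr //; by rewrite padic_int_valP.
rewrite /dvdn (residue_le y) ?leq_addl //; by rewrite padic_int_valP.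
Qed.

Definition padic_int_abs x : rat :=
  if x == 0 then 0 else p%:R ^- padic_int_val x.

Let p_gt0 : (0 : rat) < p%:R. Proof. by rewrite ltr0n prime_gt0. Qed.
Let p_gt1 : (1 : rat) < p%:R. Proof. by rewrite ltr1n prime_gt1. Qed.

Lemma padic_int_abs_ge0 x : 0 <= padic_int_abs x.
Proof. by rewrite /padic_int_abs; case: ifP => // _; rewrite invr_ge0 exprn_ge0 // ltW. Qed.

Lemma padic_int_abs_eq0 x : (padic_int_abs x == 0) = (x == 0).
Proof.
rewrite /padic_int_abs; case: ifP => // _.
by rewrite invr_eq0 expf_eq0 gt_eqF // andbF.
Qed.

Lemma padic_int_absM x y :
  padic_int_abs (x * y) = padic_int_abs x * padic_int_abs y.
Proof.
rewrite /padic_int_abs mulf_eq0; case: eqP => [_|/eqP x0] /=.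
  by rewrite mul0r.
case: eqP => [_|/eqP y0]; first by rewrite mulr0.
by rewrite padic_int_valM // exprD invfM.
Qed.

Lemma padic_int_abs_le x k : (padic_int_abs x <= p%:R ^- k) = (x k == 0%N).
Proof.
rewrite /padic_int_abs; case: eqP => [->|/eqP x0].
  by rewrite residue0 invr_ge0 exprn_ge0 // ltW.
by rewrite padic_int_valP // lef_pV2 ?posrE ?exprn_gt0 // ler_eXn2l.
Qed.

Lemma padic_int_absD x y :
  padic_int_abs (x + y) <= Num.max (padic_int_abs x) (padic_int_abs y).
Proof.
wlog xy : x y / padic_int_abs x <= padic_int_abs y => [hw|].
  have [/hw //|/hw] := orP (le_total (padic_int_abs x) (padic_int_abs y)).
  by rewrite addrC maxC.
rewrite max_r //; case: (eqVneq y 0) => [y0|y0].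
  move: xy; rewrite y0 addr0; by [].
move: xy; rewrite {2 4}/padic_int_abs (negbTE y0) !padic_int_abs_le => /eqP xv.
by rewrite residueD xv add0n residue_mod padic_int_valP.
Qed.

End PadicIntRing.

Definition padic (p : nat) (p_pr : prime p) := {fraction (padic_int p_pr)}.

HB.instance Definition _ p (p_pr : prime p) := GRing.Field.on (padic p_pr).

(* |.|_p takes its values in {0} U p^Z, hence in rat. The representative of
   the fraction chosen here is irrelevant, by [padic_abs_frac]. *)
Definition padic_abs (p : nat) (p_pr : prime p) (x : padic p_pr) : rat :=
  let r : {ratio (padic_int p_pr)} := repr x in
  padic_int_abs r.1 / padic_int_abs r.2.

Section PadicAbs.
Variables (p : nat) (p_pr : prime p).
Local Notation Qp := (padic p_pr).
Local Notation "x %:F" := (@FracField.tofrac (padic_int p_pr) x : Qp).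
Implicit Types x y z : Qp.

Lemma padic_frac_repr x : let r : {ratio (padic_int p_pr)} := repr x in
  r.2 != 0 /\ x = (r.1)%:F / (r.2)%:F.
Proof.
move=> r; split; first exact: denom_ratioP.
rewrite -[x in LHS](@reprK _ (FracField.type (padic_int p_pr))) -/r.
rewrite /GRing.inv /GRing.mul /=; move: r => r.
unlock FracField.tofrac.
rewrite -[X in _ = FracField.mul _ X]FracField.pi_inv -[RHS]FracField.pi_mul.
rewrite /FracField.mulf /FracField.invf !numden_Ratio ?oner_neq0 ?denom_ratioP //.
by rewrite mulr1 mul1r Ratio_numden.
Qed.

Lemma padic_abs_frac (a b : padic_int p_pr) : b != 0 ->
  padic_abs (a%:F / b%:F) = padic_int_abs a / padic_int_abs b.
Proof.
move=> b0; have [] := padic_frac_repr (a%:F / b%:F); rewrite /padic_abs.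
set r : {ratio _} := repr _ => d0 /eqP.
rewrite eqr_div ?tofrac_eq0 // -!tofracM tofrac_eq => /eqP ab.
by apply/eqP; rewrite eqr_div ?padic_int_abs_eq0 // -!padic_int_absM ab.
Qed.

Lemma padic_abs_ge0 x : 0 <= padic_abs x.
Proof. by rewrite divr_ge0 // padic_int_abs_ge0. Qed.

Lemma padic_abs_eq0 x : (padic_abs x == 0) = (x == 0).
Proof.
have [d0 {2}->] := padic_frac_repr x.
by rewrite !mulf_eq0 !invr_eq0 !padic_int_abs_eq0 !tofrac_eq0.
Qed.

Lemma padic_abs0 : padic_abs (0 : Qp) = 0.
Proof. by apply/eqP; rewrite padic_abs_eq0. Qed.

Lemma padic_absM x y : padic_abs (x * y) = padic_abs x * padic_abs y.
Proof.
have [] := padic_frac_repr x; move: (repr _) => [[a b] /= _] b0 ->.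
have [] := padic_frac_repr y; move: (repr _) => [[c d] /= _] d0 ->.
rewrite mulf_div -!tofracM !padic_abs_frac ?mulf_neq0 //.
by rewrite !padic_int_absM mulf_div.
Qed.

Lemma padic_absD x y :
  padic_abs (x + y) <= Num.max (padic_abs x) (padic_abs y).
Proof.
have [] := padic_frac_repr x; move: (repr _) => [[a b] /= _] b0 ->.
have [] := padic_frac_repr y; move: (repr _) => [[c d] /= _] d0 ->.
have bd0 : b * d != 0 by rewrite mulf_neq0.
have -> : a%:F / b%:F = (a * d)%:F / (b * d)%:F.
  by apply/eqP; rewrite eqr_div ?tofrac_eq0 // -!tofracM mulrAC mulrA.
have -> : c%:F / d%:F = (c * b)%:F / (b * d)%:F.
  by apply/eqP; rewrite eqr_div ?tofrac_eq0 // -!tofracM mulrA.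
rewrite -mulrDl -tofracD !padic_abs_frac //.
rewrite -maxr_pMl ?invr_ge0 ?padic_int_abs_ge0 //.
by rewrite ler_wpM2r ?invr_ge0 ?padic_int_abs_ge0 // padic_int_absD.
Qed.

Lemma padic_abs1 : padic_abs (1 : Qp) = 1.
Proof.
have /eqP : padic_abs (1 * 1 : Qp) = padic_abs (1 : Qp) by rewrite mulr1.
rewrite padic_absM -subr_eq0 -{3}[padic_abs 1]mulr1 -mulrBr mulf_eq0.
by rewrite padic_abs_eq0 oner_eq0 subr_eq0 => /eqP.
Qed.

Lemma padic_absN x : padic_abs (- x) = padic_abs x.
Proof.
rewrite -mulN1r padic_absM.
have /eqP : padic_abs (-1 : Qp) ^+ 2 = 1.
  by rewrite expr2 -padic_absM mulrNN mulr1 padic_abs1.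
by rewrite sqrp_eq1 ?padic_abs_ge0 // => /eqP ->; rewrite mul1r.
Qed.

Lemma padic_absV x : padic_abs x^-1 = (padic_abs x)^-1.
Proof.
have [->|x0] := eqVneq x 0; first by rewrite invr0 padic_abs0 invr0.
apply: (@mulIf _ (padic_abs x)); first by rewrite padic_abs_eq0.
by rewrite -padic_absM !mulVf ?padic_abs_eq0 // padic_abs1.
Qed.

Lemma padic_absX x k : padic_abs (x ^+ k) = padic_abs x ^+ k.
Proof.
elim: k => [|k IHk]; first by rewrite !expr0 padic_abs1.
by rewrite !exprS padic_absM IHk.
Qed.

Lemma padic_abs_p : padic_abs (p%:R : Qp) = p%:R^-1.
Proof.
have pE k : (p%:R : padic_int p_pr) k = (p %% p ^ k)%N by exact: residue_natr.
have p2 : (p < p ^ 2)%N by rewrite ltn_Pmull ?prime_gt1 ?prime_gt0.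
have p0 : (p%:R : padic_int p_pr) != 0.
  apply/eqP => pz; have := prime_gt0 p_pr.
  by have := pE 2%N; rewrite pz residue0 modn_small // => <-.
have v1 : padic_int_val (p%:R : padic_int p_pr) = 1%N.
  apply/eqP; rewrite eqn_leq leqNgt -!padic_int_valP // !pE.
  by rewrite modn_small // expn1 modnn -lt0n prime_gt0.
have -> : (p%:R : Qp) = (p%:R)%:F / 1%:F.
  by rewrite tofrac1 divr1 rmorph_nat.
rewrite padic_abs_frac ?oner_neq0 // {1}/padic_int_abs (negbTE p0) v1 expr1.
have -> : padic_int_abs (1 : padic_int p_pr) = 1.
  apply: (@mulIf _ (padic_int_abs (1 : padic_int p_pr))).
    by rewrite padic_int_abs_eq0 oner_eq0.
  by rewrite -padic_int_absM mulr1 mul1r.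
by rewrite divr1.
Qed.

Lemma padic_abs_pow x : x != 0 -> exists k,
  padic_abs x = p%:R ^+ k \/ padic_abs x = p%:R ^- k.
Proof.
have p0 : (p%:R : rat) != 0 by rewrite pnatr_eq0 -lt0n prime_gt0.
have [] := padic_frac_repr x; move: (repr _) => [[a b] /= _] b0 ->.
rewrite mulf_eq0 negb_or tofrac_eq0 => /andP[a0 _].
rewrite padic_abs_frac // /padic_int_abs (negbTE a0) (negbTE b0) invrK mulrC.
set k := padic_int_val a; set l := padic_int_val b.
have [kl|/ltnW lk] := leqP k l.
  by exists (l - k)%N; left; rewrite expfB_cond // (negbTE p0).
by exists (k - l)%N; right; rewrite expfB_cond ?(negbTE p0) // invf_div.
Qed.

Lemma ratr_powN k : ratr (p%:R ^- k) = p%:R ^- k :> Qp.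
Proof.
have pk_gt0 : (0 < p ^ k)%N by rewrite expn_gt0 prime_gt0.
have -> : (p%:R ^- k : rat) = 1%:~R / (p ^ k)%:Z%:~R.
  by rewrite div1r -natrX.
rewrite /ratr coprimeq_num ?coprimeq_den //= ?coprime1n //.
by rewrite gtr0_sg // mulr1 mul1r eqz_nat gtn_eqF // -natrX.
Qed.

Lemma padic_abs_ratr x : x != 0 ->
  padic_abs (ratr (padic_abs x) : Qp) = (padic_abs x)^-1.
Proof.
case/padic_abs_pow => k [] ->.
  by rewrite -natrX ratr_nat !natrX padic_absX padic_abs_p exprVn.
by rewrite ratr_powN padic_absV padic_absX padic_abs_p exprVn.
Qed.
End PadicAbs.

Section PadicMetric.
Variables (p : nat) (p_pr : prime p).
Local Notation Qp := (padic p_pr).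
Implicit Types x y z : Qp.

Definition padic_dist x y : rat := padic_abs (x - y).

Let dist_xx x : padic_dist x x = 0.
Proof. by rewrite /padic_dist subrr padic_abs0. Qed.
Let dist_eq0 x y : padic_dist x y = 0 -> x = y.
Proof. by move/eqP; rewrite padic_abs_eq0 subr_eq0 => /eqP. Qed.
Let dist_sym x y : padic_dist x y = padic_dist y x.
Proof. by rewrite /padic_dist -padic_absN opprB. Qed.
Let dist_triangle y x z : padic_dist x z <= padic_dist x y + padic_dist y z.
Proof.
rewrite /padic_dist -(subrKA y); apply: le_trans (padic_absD _ _) _.
by rewrite ge_max lerDl lerDr !padic_abs_ge0.
Qed.

HB.instance Definition _ :=
  isMetric.Build rat Qp dist_xx dist_eq0 dist_sym dist_triangle.
End PadicMetric.

Section PadicSphere.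
Variables (p : nat) (p_pr : prime p) (n : nat).
Local Notation Qp := (padic p_pr).
Implicit Types (u v : 'cV[Qp]_n) (T : 'M[Qp]_n).

Definition padic_norm v : rat := \big[Num.max/0]_(i < n) padic_abs (v i 0).

Definition padic_sphere : set 'cV[Qp]_n := [set v | padic_norm v = 1].

(* ||v||_p v, the rational power of p ||v||_p being cast to Q_p by [ratr]. *)
Definition padic_normalize v : 'cV[Qp]_n := ratr (padic_norm v) *: v.

(* [insubd x] is here only to avoid a partial function: the default value x is
   used only if a + T x = 0, see [affine_sphere_mapE]. *)
Definition affine_sphere_map T (a : 'cV[Qp]_n) (x : padic_sphere) :
  padic_sphere := insubd x (padic_normalize (a + T *m val x)).

Definition linear_sphere_map T (x : padic_sphere) : padic_sphere :=
  insubd x (padic_normalize (T *m val x)).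

Lemma padic_norm_ge0 v : 0 <= padic_norm v.
Proof. exact: bigmax_ge_id. Qed.

Lemma le_padic_norm v i : padic_abs (v i 0) <= padic_norm v.
Proof. exact: le_bigmax. Qed.

Lemma padic_norm_witness v : v != 0 ->
  exists2 i, v i 0 != 0 & padic_norm v = padic_abs (v i 0).
Proof.
move=> v0; have [i vi0] : exists i, v i 0 != 0.
  apply: contrapT => nv; case/eqP: v0; apply/colP => i; rewrite mxE.
  by apply/eqP; apply: contrapT => /negP vi0; apply: nv; exists i.
have [j _ vE] := @Order.TotalTheory.eq_bigmax _ rat _ 0 i predT
  (fun i => padic_abs (v i 0)) isT (fun i _ => padic_abs_ge0 (v i 0)).
exists j; last exact: vE.
rewrite -padic_abs_eq0 -vE gt_eqF // (lt_le_trans _ (le_padic_norm v i)) //.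
by rewrite lt_def padic_abs_eq0 vi0 padic_abs_ge0.
Qed.

Lemma padic_norm0 : padic_norm (0 : 'cV[Qp]_n) = 0.
Proof.
by rewrite /padic_norm big1_idem //= ?maxxx // => i _; rewrite mxE padic_abs0.
Qed.

Lemma padic_normZ (c : Qp) v : padic_norm (c *: v) = padic_abs c * padic_norm v.
Proof.
rewrite /padic_norm (big_morph ( *%R (padic_abs c)) (id1 := 0) (op1 := Num.max)).
- by apply: eq_bigr => i _; rewrite mxE padic_absM.
- by move=> x y; rewrite maxr_pMr // padic_abs_ge0.
- exact: mulr0.
Qed.

Lemma padic_normalize_sphere v : v != 0 -> padic_sphere (padic_normalize v).
Proof.
move=> /padic_norm_witness[i vi0 vE].
rewrite /padic_sphere /= /padic_normalize padic_normZ vE padic_abs_ratr //.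
by rewrite mulVf // padic_abs_eq0.
Qed.

Lemma padic_affine_neq0 T a (x : padic_sphere) : T \in unitmx ->
  padic_norm (invmx T *m a) < 1 -> a + T *m val x != 0.
Proof.
move=> Tu ha; apply/eqP => /(congr1 (mulmx (invmx T))).
rewrite mulmxDr mulKmx // mulmx0 => /eqP; rewrite addr_eq0 => /eqP aE.
have /set_mem xS := valP x; move: ha.
rewrite aE -scaleN1r padic_normZ padic_absN padic_abs1 mul1r.
by rewrite [padic_norm _]xS ltxx.
Qed.

Lemma affine_sphere_mapE T a (x : padic_sphere) : T \in unitmx ->
  padic_norm (invmx T *m a) < 1 ->
  val (affine_sphere_map T a x) = padic_normalize (a + T *m val x).
Proof.
move=> Tu ha; rewrite insubdK //; apply/mem_set/padic_normalize_sphere.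
exact: padic_affine_neq0.
Qed.

Lemma linear_sphere_mapE T (x : padic_sphere) : T \in unitmx ->
  val (linear_sphere_map T x) = padic_normalize (T *m val x).
Proof.
move=> Tu; have := @affine_sphere_mapE T 0 x Tu.
rewrite /affine_sphere_map add0r; apply.
by rewrite mulmx0 padic_norm0.
Qed.
End PadicSphere.

Definition iterz (X : Type) (f g : X -> X) (k : int) : X -> X :=
  match k with Posz m => iter m f | Negz m => iter m.+1 g end.

(* phi is a homeomorphism, with inverse psi, and no orbit closure of a pair of
   distinct points meets the diagonal. *)
Definition distal (X : topologicalType) (phi : X -> X) : Prop :=
  exists psi : X -> X,
    [/\ cancel phi psi, cancel psi phi, continuous phi, continuous psi &
      forall x y : X, x <> y ->
        closure [set z : X * X |
                  exists k : int, z = (iterz phi psi k x, iterz phi psi k y)]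
        `&` diagonal = set0].

(* Main.v *)
From HB Require Import structures.
Require Import Defs.
From mathcomp Require Import all_boot all_order all_algebra.
From mathcomp Require Import all_classical all_reals all_analysis.
From mathcomp Require Import ring.

Import Order.TTheory GRing.Theory Num.Theory.
Local Open Scope classical_set_scope.
Local Open Scope ring_scope.

Set Implicit Arguments.
Unset Strict Implicit.
Unset Printing Implicit Defensive.

(** The norms of the iterates of [T] grow at an exactly geometric rate: there
are [P], [C] and a unit vector [x] with [N (T^k v) <= C P^k N v] and [P^k <= C
N (T^k x)], where [N] is a fixed power of the norm. Either every [v] satisfies
[P^k N v <= C' N (T^k v)] with a common [C'], or a single [w <> 0] satisfies
[N (T^k w) < eps P^k] for some [k], whatever [eps]. For small [a], as long as
[T^k x] grows at the maximal rate, the orbits under the map of [T] and [a] of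
[x] and of a nearby [y] use the same scalars, so that they differ by a scalar
times [T^k (x - y)], the scalar having norm [1 / |T^k x|]. In the first case
the map and its inverse thus have equicontinuous iterates, and the map is
distal; in the second case [x] and [x + d w] are proximal. Hence the map of
[T] and [a] is distal for one small [a], possibly [0], if and only if it is so
for all small [a]. *)

(** * The ultrametric norm on column vectors *)

Section PadicNorm.
Variables (p : nat) (p_pr : prime p).
Local Notation Qp := (padic p_pr).

Lemma padic_abs_sum (I : Type) (s : seq I) (P : pred I) (F : I -> Qp) r :
  0 <= r -> (forall i, P i -> padic_abs (F i) <= r) ->
  padic_abs (\sum_(i <- s | P i) F i) <= r.
Proof.
move=> r0 Fr; elim/big_ind : _ => //; first by rewrite padic_abs0.
by move=> x y xr yr; rewrite (le_trans (padic_absD _ _)) // ge_max xr.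
Qed.

Variable n : nat.
Implicit Types u v : 'cV[Qp]_n.

Lemma padic_norm_le v r : 0 <= r -> (forall i, padic_abs (v i 0) <= r) ->
  padic_norm v <= r.
Proof. by move=> r0 vr; apply: bigmax_le. Qed.

Lemma padic_norm_eq0 v : (padic_norm v == 0) = (v == 0).
Proof.
have [->|v0] := eqVneq v 0; first by rewrite padic_norm0 eqxx.
have [i vi0 ->] := padic_norm_witness v0.
by rewrite padic_abs_eq0 (negbTE vi0).
Qed.

Lemma padic_norm_gt0 v : (0 < padic_norm v) = (v != 0).
Proof. by rewrite lt_def padic_norm_ge0 andbT padic_norm_eq0. Qed.

Lemma padic_normD u v :
  padic_norm (u + v) <= Num.max (padic_norm u) (padic_norm v).
Proof.
apply: padic_norm_le => [|i]; first by rewrite le_max padic_norm_ge0.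
by rewrite mxE (le_trans (padic_absD _ _)) // ge_max !le_max !le_padic_norm ?orbT.
Qed.

Lemma padic_normN v : padic_norm (- v) = padic_norm v.
Proof. by rewrite -scaleN1r padic_normZ padic_absN padic_abs1 mul1r. Qed.

Lemma padic_abs_ratr_norm v : v != 0 ->
  padic_abs (ratr (padic_norm v) : Qp) = (padic_norm v)^-1.
Proof. by case/padic_norm_witness => i vi0 ->; rewrite padic_abs_ratr. Qed.

End PadicNorm.

Lemma padic_norm_mulmx (p : nat) (p_pr : prime p) m n
    (A : 'M[padic p_pr]_(m, n)) : exists2 C, 1 <= C &
  forall v, padic_norm (A *m v) <= C * padic_norm v.
Proof.
pose C := \big[Num.max/1]_(i < m) \big[Num.max/1]_(j < n) padic_abs (A i j).
have C1 : 1 <= C by exact: bigmax_ge_id.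
exists C => // v; have C0 := le_trans ler01 C1.
apply: padic_norm_le => [|i]; first by rewrite mulr_ge0 ?padic_norm_ge0.
rewrite mxE padic_abs_sum ?mulr_ge0 ?padic_norm_ge0 // => j _.
rewrite padic_absM ler_pM ?padic_abs_ge0 ?le_padic_norm //.
apply: le_trans (le_bigmax _ _ i); exact: le_bigmax.
Qed.


(** * Powers of the norm *)

(** A positive power of an ultrametric norm is still ultrametric; taking [e] to be n! makes the
    growth rates rational. *)
Definition wnorm (p : nat) (p_pr : prime p) n e (v : 'cV[padic p_pr]_n) : rat :=
  padic_norm v ^+ e.

Section WeightedNorm.
Variables (p : nat) (p_pr : prime p) (e : nat).
Hypothesis e_gt0 : (0 < e)%N.
Local Notation Qp := (padic p_pr).
Local Notation N v := (wnorm e v).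

Section Basic.
Variable n : nat.
Implicit Types u v : 'cV[Qp]_n.

Lemma wnorm_ge0 v : 0 <= N v.
Proof. by rewrite exprn_ge0 ?padic_norm_ge0. Qed.

Lemma wnorm0 : N (0 : 'cV[Qp]_n) = 0.
Proof. by rewrite /wnorm padic_norm0 expr0n gtn_eqF. Qed.

Lemma wnorm_gt0 v : (0 < N v) = (v != 0).
Proof.
have [->|v0] := eqVneq v 0; first by rewrite wnorm0 ltxx.
by rewrite exprn_gt0 // padic_norm_gt0.
Qed.

Lemma le_wnorm u v : (N u <= N v) = (padic_norm u <= padic_norm v).
Proof. by rewrite ler_pXn2r // ?nnegrE ?padic_norm_ge0. Qed.

Lemma wnorm_inj u v : N u = N v -> padic_norm u = padic_norm v.
Proof. by move/eqP; rewrite eqrXn2 ?padic_norm_ge0 // => /eqP. Qed.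

Lemma wnormD u v r : N u <= r -> N v <= r -> N (u + v) <= r.
Proof.
move=> ur vr; have := padic_normD u v.
by rewrite le_max -!le_wnorm => /orP[]/le_trans; apply.
Qed.

Lemma wnormD_lt u v r : N u < r -> N v < r -> N (u + v) < r.
Proof.
move=> ur vr; have := padic_normD u v.
by rewrite le_max -!le_wnorm => /orP[]/le_lt_trans; apply.
Qed.

Lemma wnormN v : N (- v) = N v.
Proof. by rewrite /wnorm padic_normN. Qed.

Lemma wnormB u v : N (u - v) = N (v - u).
Proof. by rewrite -wnormN opprB. Qed.

(** Isosceles principle: otherwise u = (u + v) - v would be smaller than itself. *)
Lemma wnormDl u v : N v < N u -> N (u + v) = N u.
Proof.
move=> vu; apply/eqP; rewrite eq_le wnormD ?(ltW vu) //= leNgt.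
apply/negP => uvu.
suff : N (u + v - v) < N u by rewrite addrK ltxx.
by rewrite wnormD_lt // wnormN.
Qed.

Lemma wnormZ c v : N (c *: v) = padic_abs c ^+ e * N v.
Proof. by rewrite /wnorm padic_normZ exprMn. Qed.

Lemma wnorm_sum (I : Type) (s : seq I) (P : pred I) (F : I -> 'cV[Qp]_n) r :
  0 <= r -> (forall i, P i -> N (F i) <= r) -> N (\sum_(i <- s | P i) F i) <= r.
Proof.
move=> r0 Fr; elim/big_ind : _ => //; first by rewrite wnorm0.
by move=> x y xr yr; rewrite wnormD.
Qed.

Lemma wnorm_lt v r : 0 < r -> (padic_norm v < r) = (N v < r ^+ e).
Proof. by move=> r0; rewrite ltr_pXn2r // ?nnegrE ?padic_norm_ge0 ?ltW. Qed.

Lemma wnorm_eq1 v : (N v == 1) = (padic_norm v == 1).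
Proof. by rewrite /wnorm -(expr1n _ e) eqrXn2 ?padic_norm_ge0 ?expr1n. Qed.

Lemma wnorm_lt1 v : (N v < 1) = (padic_norm v < 1).
Proof. by rewrite (wnorm_lt v ltr01) expr1n. Qed.

(** A positive power decreases numbers below one; bounding the norm by [Num.min 1 r] thus avoids
    e-th roots of [r]. *)
Lemma wnorm_small v r : padic_norm v < Num.min 1 r -> N v < r.
Proof.
rewrite lt_min => /andP[v1 /(le_lt_trans _)]; apply.
by rewrite -[leRHS]expr1 ler_wiXn2l ?padic_norm_ge0 // ltW.
Qed.

End Basic.

Lemma wnorm_mulmx m n (A : 'M[Qp]_(m, n)) : exists2 C, 1 <= C &
  forall v, N (A *m v) <= C * N v.
Proof.
have [C C1 CP] := padic_norm_mulmx A; exists (C ^+ e) => [|v].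
  by rewrite exprn_ege1.
rewrite /wnorm -exprMn lerXn2r ?nnegrE ?padic_norm_ge0 //.
by rewrite mulr_ge0 ?padic_norm_ge0 ?(le_trans ler01).
Qed.

End WeightedNorm.

Lemma padic_normDl (p : nat) (p_pr : prime p) n (u v : 'cV[padic p_pr]_n) :
  padic_norm v < padic_norm u -> padic_norm (u + v) = padic_norm u.
Proof. exact: (@wnormDl p p_pr 1 isT n u v). Qed.

(** * Compactness of the unit ball, by ultrafilters *)

Section Compactness.
Variables (p : nat) (p_pr : prime p).
Local Notation Zp := (padic_int p_pr).
Local Notation Qp := (padic p_pr).
Local Notation "x %:F" := (@FracField.tofrac Zp x : Qp).

(** An ultrafilter contains the fibre of the top value or its complement, on which the bound drops
    by one. *)
Lemma ultra_bounded_value (I : Type) (F : set_system I) (g : I -> nat) m :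
  UltraFilter F -> F [set i | (g i < m)%N] -> exists r, F [set i | g i = r].
Proof.
move=> UF; elim: m => [|m IHm] Fm.
  by case: (filter_not_empty F); apply: filterS Fm => i /=; rewrite ltn0.
have [|Fn] := in_ultra_setVsetC [set i | g i = m] UF; first by exists m.
apply: IHm; apply: filterS (filterI Fm Fn) => i [/=].
by rewrite ltnS leq_eqVlt => /predU1P[].
Qed.

(** Each residue takes finitely many values, hence is constant along [F]; two successive constants
    are compatible because some index realizes both. *)
Lemma padic_int_ultra_lim (I : Type) (F : set_system I) (f : I -> Zp) :
  UltraFilter F -> exists d : Zp, forall k, F [set i | f i k = d k].
Proof.
move=> UF.
have /choice[r rP] k : exists r, F [set i | f i k = r].
  apply: (@ultra_bounded_value _ _ _ (p ^ k)%N).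
  by apply: filterE => i /=; exact: residue_lt.
have rS k : (r k.+1 %% p ^ k)%N = r k.
  have [i [/= <- <-]] := filter_ex (filterI (rP k.+1) (rP k)).
  exact: residueS.
by exists (PadicInt p_pr (introT (asboolP _) rS)).
Qed.

Lemma padic_int_residue_eq (x y : Zp) k : x k = y k -> (x - y) k = 0%N.
Proof.
by rewrite residueD residueN => ->; rewrite modnDmr subnKC ?modnn // ltnW ?residue_lt.
Qed.

Lemma expn_gt_id k : (k < p ^ k)%N.
Proof. exact: ltn_expl (prime_gt1 p_pr). Qed.

Lemma padic_eps (eps : rat) : 0 < eps -> exists k, p%:R ^- k < eps.
Proof.
move=> e0; exists (Num.bound eps^-1).
rewrite invf_plt ?posrE ?exprn_gt0 ?ltr0n ?prime_gt0 //.
apply: lt_trans (archi_boundP _) _; first by rewrite invr_ge0 ltW.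
by rewrite -natrX ltr_nat expn_gt_id.
Qed.

(** Modulo p^k, either both residues vanish, or b is p^v times an integer prime to p and p^v divides
    a. *)
Lemma padic_int_approx_div (a b : Zp) k : b != 0 ->
  padic_int_abs a <= padic_int_abs b ->
  exists z : nat, (b * z%:R) k = a k.
Proof.
move=> b0 ab; have [kv|vk] := leqP k (padic_int_val b).
  have bk : b k = 0%N by apply/eqP; rewrite padic_int_valP.
  have ak : a k = 0%N.
    apply/eqP; rewrite -padic_int_abs_le (le_trans ab) //.
    by rewrite padic_int_abs_le bk.
  by exists 0%N; rewrite ak mulr0 residue0.
have [u bE pu] := residue_val b0 vk; set v := padic_int_val b in vk bE.
have av : a v = 0%N.
  apply/eqP; rewrite -padic_int_abs_le (le_trans ab) //.
  by rewrite padic_int_abs_le padic_int_valP.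
have /dvdnP[w aE] : (p ^ v %| a k)%N.
  by rewrite /dvdn (residue_le a (ltnW vk)) av.
have cop : coprime u (p ^ k) by rewrite coprime_sym coprimeXl // prime_coprime.
(* The Chinese remainder is a multiple t u congruent to 1, so t inverts u modulo p^k. *)
have /dvdnP[t tE] : (u %| chinese u (p ^ k) 0 1)%N.
  by rewrite /dvdn (chinese_modl cop) mod0n.
exists (t * w)%N; rewrite residueM residue_natr modnMmr bE -(residue_mod a) aE.
rewrite -mulnA (mulnA u) (mulnC u t) -tE mulnCA -modnMml (chinese_modr cop).
by rewrite modnMml mul1n mulnC.
Qed.

(* Division in Z_p by compactness: a cluster point of the approximate
   quotients is an exact one. *)
Lemma padic_int_dvd (a b : Zp) : b != 0 -> padic_int_abs a <= padic_int_abs b ->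
  exists z, a = b * z.
Proof.
move=> b0 ab.
have /choice[z zP] k := padic_int_approx_div k b0 ab.
have [G [UG sG]] := ultraFilterLemma eventually_filter.
have [d dP] := @padic_int_ultra_lim _ G (fun k => (z k)%:R) UG.
exists d; apply: padic_int_eq => k.
have Gk : G [set j | (k <= j)%N] by apply: sG; exists k.
have [j [/= kj jd]] := filter_ex (filterI Gk (dP k)).
rewrite -(residue_le a kj) -zP residue_le // !residueM jd.
by [].
Qed.

(** Reduces limits in the closed unit ball of Q_p to limits of residues in Z_p. *)
Lemma padic_ball1 (x : Qp) : padic_abs x <= 1 -> exists z : Zp, x = z%:F.
Proof.
have [] := padic_frac_repr x; move: (repr _) => [[a b] /= _] b0 ->.
rewrite padic_abs_frac // ler_pdivrMr; last first.
  by rewrite lt_def padic_int_abs_eq0 b0 padic_int_abs_ge0.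
rewrite mul1r => /(padic_int_dvd b0)[z ->]; exists z.
by rewrite tofracM mulrAC divff ?mul1r // tofrac_eq0.
Qed.

Lemma padic_abs_tofrac (a : Zp) : padic_abs (a%:F) = padic_int_abs a.
Proof.
have abs1 : padic_int_abs (1 : Zp) = 1.
  apply: (@mulIf _ (padic_int_abs (1 : Zp))).
    by rewrite padic_int_abs_eq0 oner_eq0.
  by rewrite -padic_int_absM mulr1 mul1r.
by have := padic_abs_frac a (oner_neq0 Zp); rewrite tofrac1 divr1 abs1 divr1.
Qed.

Lemma padic_ultra_lim (I : Type) (F : set_system I) (f : I -> Qp) :
  UltraFilter F -> (forall i, padic_abs (f i) <= 1) ->
  exists d : Qp, forall eps, 0 < eps -> F [set i | padic_abs (f i - d) < eps].
Proof.
move=> UF f1; have /choice[g gP] i := padic_ball1 (f1 i).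
have [d dP] := padic_int_ultra_lim g UF; exists d%:F => eps.
move=> /padic_eps[k keps]; apply: filterS (dP k) => i /= gd.
rewrite gP -tofracB padic_abs_tofrac (le_lt_trans _ keps) //.
by rewrite padic_int_abs_le padic_int_residue_eq.
Qed.

Lemma padic_norm_ultra_lim n (I : Type) (F : set_system I)
    (f : I -> 'cV[Qp]_n) :
  UltraFilter F -> (forall i, padic_norm (f i) <= 1) ->
  exists d, forall eps, 0 < eps -> F [set i | padic_norm (f i - d) < eps].
Proof.
move=> UF f1.
have /choice[d dP] j : exists d : Qp, forall eps, 0 < eps ->
    F [set i | padic_abs (f i j 0 - d) < eps].
  by apply: padic_ultra_lim => i; apply: le_trans (f1 i); exact: le_padic_norm.
exists (\col_j d j) => eps e0.
apply: filterS (filter_forall _ (fun j => dP j eps e0)) => i /= fd.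
have [->|/padic_norm_witness[j _ ->]] := eqVneq (f i - \col_j d j) 0.
  by rewrite padic_norm0.
by rewrite !mxE fd.
Qed.

End Compactness.

(** * Weighted growth under a companion matrix *)

Section Companion.
Variables (p : nat) (p_pr : prime p) (e : nat).
Hypothesis e_gt0 : (0 < e)%N.
Local Notation Qp := (padic p_pr).
Local Notation N x := (padic_abs x ^+ e).
Implicit Types x y : Qp.

Lemma padic_absX_ge0 x : 0 <= N x.
Proof. by rewrite exprn_ge0 ?padic_abs_ge0. Qed.

Lemma le_padic_absX x y : (N x <= N y) = (padic_abs x <= padic_abs y).
Proof. by rewrite ler_pXn2r // ?nnegrE ?padic_abs_ge0. Qed.

Lemma padic_absXM x y : N (x * y) = N x * N y.
Proof. by rewrite padic_absM exprMn. Qed.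

Lemma padic_absX0 : N (0 : Qp) = 0.
Proof. by rewrite padic_abs0 expr0n gtn_eqF. Qed.

Lemma padic_absXD x y r : N x <= r -> N y <= r -> N (x + y) <= r.
Proof.
move=> xr yr; have := padic_absD x y.
by rewrite le_max -!le_padic_absX => /orP[]/le_trans; apply.
Qed.

Lemma padic_absXD_lt x y r : N x < r -> N y < r -> N (x + y) < r.
Proof.
move=> xr yr; have := padic_absD x y.
by rewrite le_max -!le_padic_absX => /orP[]/le_lt_trans; apply.
Qed.

Lemma padic_absXDl x y : N y < N x -> N (x + y) = N x.
Proof.
move=> yx; apply/eqP; rewrite eq_le padic_absXD ?(ltW yx) //= leNgt.
apply/negP => xyx; suff : N (x + y - y) < N x by rewrite addrK ltxx.
by rewrite padic_absXD_lt // padic_absN.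
Qed.

Variables (m : nat) (alpha : nat -> Qp).

(** The coefficients of T applied to the sum of the b_i T^i v, i <= m, when T^(m+1) v is the sum of
    the alpha_i T^i v. *)
Definition companion (b : nat -> Qp) (i : nat) : Qp :=
  (if i is j.+1 then b j else 0) + alpha i * b m.

Variable P : rat.
Hypothesis P_gt0 : 0 < P.
Hypothesis alpha_le : forall i, (i <= m)%N -> N (alpha i) * P ^+ i <= P ^+ m.+1.

Lemma companion_term (b : nat -> Qp) K i : N (b m) * P ^+ m <= K ->
  N (alpha i * b m) * P ^+ i <= (N (alpha i) * P ^+ i / P ^+ m) * K.
Proof.
move=> bm; have Pm : 0 < P ^+ m by rewrite exprn_gt0.
rewrite padic_absXM.
have -> : N (alpha i) * N (b m) * P ^+ i =
    (N (alpha i) * P ^+ i / P ^+ m) * (N (b m) * P ^+ m).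
  by field; rewrite gt_eqF.
by rewrite ler_wpM2l // divr_ge0 ?(ltW Pm) // mulr_ge0 ?padic_absX_ge0 ?exprn_ge0 ?(ltW P_gt0).
Qed.

Lemma alpha_ratio_le i : (i <= m)%N -> N (alpha i) * P ^+ i / P ^+ m <= P.
Proof. by move=> im; rewrite ler_pdivrMr ?exprn_gt0 // -exprS alpha_le. Qed.

(** For the norm max N(b_i) P^i, the shift scales by at most P, and [alpha_le] bounds the last
    column by P as well. *)
Lemma companion_le (b : nat -> Qp) K :
  (forall i, (i <= m)%N -> N (b i) * P ^+ i <= K) ->
  forall i, (i <= m)%N -> N (companion b i) * P ^+ i <= P * K.
Proof.
move=> bK i im; have K0 : 0 <= K.
  by apply: le_trans (bK m _) => //; rewrite mulr_ge0 ?padic_absX_ge0 ?exprn_ge0 ?(ltW P_gt0).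
have Pi : 0 < P ^+ i by rewrite exprn_gt0.
rewrite -ler_pdivlMr // padic_absXD // ler_pdivlMr //; last first.
  apply: le_trans (companion_term _ (bK m (leqnn m))) _.
  by rewrite ler_wpM2r // alpha_ratio_le.
case: i im {Pi} => [|i] im; first by rewrite padic_absX0 mul0r mulr_ge0 // ltW.
by rewrite exprS mulrCA ler_wpM2l ?(ltW P_gt0) // bK // ltnW.
Qed.

(** Reading b as a polynomial in X, its part of full weight K is a nonzero multiple of X^i0. *)
Definition companion_dominant i0 (b : nat -> Qp) K :=
  [/\ forall i, (i <= m)%N -> N (b i) * P ^+ i <= K,
      forall i, (i < i0)%N -> N (b i) * P ^+ i < K &
      exists i, [/\ (i0 <= i)%N, (i <= m)%N & N (b i) * P ^+ i = K]].

(* Modulo the terms of smaller weight, the companion matrix is that of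
   X^i0 g with g(0) <> 0, which acts injectively on the multiples of X^i0. *)
Lemma companion_dominantS i0 b K : 0 < K -> (i0 <= m)%N ->
  N (alpha i0) * P ^+ i0 = P ^+ m.+1 ->
  (forall i, (i < i0)%N -> N (alpha i) * P ^+ i < P ^+ m.+1) ->
  companion_dominant i0 b K -> companion_dominant i0 (companion b) (P * K).
Proof.
move=> K0 i0m eq_alpha lt_alpha [bK bK_lt [l [i0l lm blK]]].
have Pi i : 0 < P ^+ i by rewrite exprn_gt0.
split; first exact: companion_le.
  move=> i ii0; rewrite -ltr_pdivlMr // padic_absXD_lt // ltr_pdivlMr //.
    case: i ii0 => [|i] ii0; first by rewrite padic_absX0 mul0r mulr_gt0.
    by rewrite exprS mulrCA ltr_pM2l // bK_lt // ltnW.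
  apply: le_lt_trans (companion_term _ (bK m (leqnn m))) _.
  by rewrite ltr_pM2r // ltr_pdivrMr // -exprS lt_alpha.
have alpha_b i : N (alpha i * b m) * P ^+ i =
    (N (alpha i) * P ^+ i / P ^+ m) * (N (b m) * P ^+ m).
  by rewrite padic_absXM; field; rewrite gt_eqF.
(* A top coefficient of full weight feeds index i0 through [alpha i0], and the term shifted there
   from below is strictly smaller. *)
have [bm|bm] := eqVneq (N (b m) * P ^+ m) K.
  exists i0; split => //.
  have top : N (alpha i0 * b m) * P ^+ i0 = P * K.
    by rewrite alpha_b bm eq_alpha exprS mulfK // gt_eqF.
  rewrite -top; congr (_ * _); rewrite /companion addrC padic_absXDl //.
  rewrite -(ltr_pM2r (Pi i0)) top; case: (i0) bK_lt => [|i] bK_lt.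
    by rewrite padic_absX0 mul0r mulr_gt0.
  by rewrite exprS mulrCA ltr_pM2l // bK_lt.
(* Otherwise all the [alpha] terms are too small, and a coefficient of full weight at l < m moves to
   l + 1. *)
have {}bm : N (b m) * P ^+ m < K by rewrite lt_neqAle bm bK.
have lm' : (l < m)%N.
  rewrite ltn_neqAle lm andbT; apply/eqP => lE.
  by move: bm; rewrite -lE blK ltxx.
exists l.+1; split => //; first exact: ltnW.
have top : N (b l) * P ^+ l.+1 = P * K by rewrite exprS mulrCA blK.
rewrite -top; congr (_ * _); rewrite /companion padic_absXDl //.
rewrite -(ltr_pM2r (Pi l.+1)) top alpha_b.
apply: le_lt_trans (_ : P * (N (b m) * P ^+ m) < _); last by rewrite ltr_pM2l.
rewrite ler_wpM2r ?alpha_ratio_le //.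
by rewrite mulr_ge0 ?padic_absX_ge0 ?ltW.
Qed.

Lemma companion_iter_le b K :
  (forall i, (i <= m)%N -> N (b i) * P ^+ i <= K) ->
  forall k i, (i <= m)%N -> N (iter k companion b i) * P ^+ i <= P ^+ k * K.
Proof.
move=> bK; elim=> [|k IHk]; first by rewrite mul1r.
by rewrite exprS -mulrA; exact: companion_le.
Qed.

Lemma companion_iter_dominant i0 b K : 0 < K -> (i0 <= m)%N ->
  N (alpha i0) * P ^+ i0 = P ^+ m.+1 ->
  (forall i, (i < i0)%N -> N (alpha i) * P ^+ i < P ^+ m.+1) ->
  companion_dominant i0 b K ->
  forall k, companion_dominant i0 (iter k companion b) (P ^+ k * K).
Proof.
move=> K0 i0m a1 a2 bK; elim=> [|k IHk]; first by rewrite mul1r.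
rewrite exprS -mulrA; apply: companion_dominantS => //.
by rewrite mulr_gt0 ?exprn_gt0.
Qed.

End Companion.

(** * Iterates of a vector and their linear relations *)

Section Iterates.
Variables (p : nat) (p_pr : prime p) (n : nat).
Local Notation Qp := (padic p_pr).
Implicit Types (u v : 'cV[Qp]_n) (T : 'M[Qp]_n).

Definition mxiter T k v := iter k (mulmx T) v.
Arguments mxiter : simpl never.

Lemma mxiterS T k v : mxiter T k.+1 v = T *m mxiter T k v. Proof. by []. Qed.

Lemma mxiterD T j k v : mxiter T j (mxiter T k v) = mxiter T (j + k) v.
Proof. by rewrite /mxiter iterD. Qed.

Lemma mxiter_is_linear T k : linear (mxiter T k).
Proof.
by move=> c u v; elim: k => // k IHk; rewrite !mxiterS IHk linearP.
Qed.
HB.instance Definition _ T k :=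
  GRing.isLinear.Build Qp 'cV[Qp]_n 'cV[Qp]_n *:%R (mxiter T k)
    (mxiter_is_linear T k).

Lemma mxiterK T k : T \in unitmx -> cancel (mxiter T k) (mxiter (invmx T) k).
Proof.
move=> Tu v; elim: k => // k IHk.
by rewrite (mxiterS T) [LHS]/mxiter iterSr mulKmx.
Qed.

Lemma mxiter_eq0 T k v : T \in unitmx -> (mxiter T k v == 0) = (v == 0).
Proof. by move=> Tu; rewrite -(inj_eq (can_inj (mxiterK k Tu))) linear0. Qed.

Lemma mxiter_companion T m (alpha b : nat -> Qp) v :
  mxiter T m.+1 v = \sum_(i < m.+1) alpha i *: mxiter T i v ->
  forall k, mxiter T k (\sum_(i < m.+1) b i *: mxiter T i v) =
    \sum_(i < m.+1) iter k (companion m alpha) b i *: mxiter T i v.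
Proof.
move=> Tm; elim=> // k IHk.
rewrite mxiterS IHk /=; set c := iter k _ b.
rewrite linear_sum big_ord_recr /= linearZ /= -mxiterS Tm scaler_sumr.
rewrite [in LHS]big_ord_recl [in RHS]big_ord_recl /= addrCA.
rewrite [X in _ = X *: _ + _]/companion add0r scalerA (mulrC (c m)); congr (_ + _).
rewrite -big_split /=; apply: eq_bigr => i _.
by rewrite linearZ /= -mxiterS /companion scalerDl scalerA (mulrC (c m)).
Qed.

Definition mxiter_dependent T v m :=
  exists alpha : nat -> Qp, mxiter T m v = \sum_(i < m) alpha i *: mxiter T i v.

Lemma mxiter_free T v m : (forall j, (j < m)%N -> ~ mxiter_dependent T v j) ->
  forall b : nat -> Qp, \sum_(i < m) b i *: mxiter T i v = 0 ->
  forall i, (i < m)%N -> b i = 0.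
Proof.
elim: m => [|m IHm] indep b; first by [].
rewrite big_ord_recr /= => sum0.
have bm0 : b m = 0.
  (* A nonzero last coefficient would express T^m v through the earlier iterates. *)
  apply/eqP/negPn/negP => bm; apply: (indep m) => //.
  exists (fun i => - (b i / b m)).
  apply: (scalerI bm); rewrite scaler_sumr.
  move/eqP: sum0; rewrite addrC addr_eq0 => /eqP ->; rewrite -sumrN.
  by apply: eq_bigr => i _; rewrite scalerA mulrN scaleNr mulrC divfK.
move=> i; rewrite ltnS leq_eqVlt => /predU1P[->//|im].
apply: (IHm _ b) => // [j jm|]; first exact/indep/ltnW.
by move: sum0; rewrite bm0 scale0r addr0.
Qed.

Definition krylov T v m : 'M[Qp]_(m, n) := \matrix_(i, j) mxiter T i v j 0.

Lemma mul_krylov T v m (b : nat -> Qp) :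
  (\row_(i < m) b i) *m krylov T v m = (\sum_(i < m) b i *: mxiter T i v)^T.
Proof.
rewrite mulmx_sum_row linear_sum; apply: eq_bigr => i _.
by rewrite mxE linearZ; congr (_ *: _); apply/rowP => j; rewrite !mxE.
Qed.

Lemma krylov_free T v m :
  (forall j, (j < m)%N -> ~ mxiter_dependent T v j) -> row_free (krylov T v m).
Proof.
move=> indep; apply: inj_row_free => w.
pose b i := if insub i is Some i' then w 0 i' else 0.
have -> : w = \row_(i < m) b i.
  by apply/rowP => i; rewrite mxE /b valK.
rewrite mul_krylov => /(congr1 trmx); rewrite trmxK trmx0 => b0.
by apply/rowP => i; rewrite !mxE (mxiter_free indep b0).
Qed.

(** Here [m] is the degree of the minimal polynomial of [v] under [T]; a row-free Krylov matrix has
    at most n rows. *)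
Lemma mxiter_minpoly T v : exists2 m, (m <= n)%N & mxiter_dependent T v m /\
  forall j, (j < m)%N -> ~ mxiter_dependent T v j.
Proof.
have [m mdep] : exists m, `[< mxiter_dependent T v m >].
  apply: contrapT => indep.
  have /krylov_free : forall j, (j < n.+1)%N -> ~ mxiter_dependent T v j.
    by move=> j _ jd; apply: indep; exists j; apply/asboolP.
  by move=> /eqP free; have := rank_leq_col (krylov T v n.+1); rewrite free ltnn.
have [{}m {}mdep m_min] := ex_minnP (ex_intro (fun m => `[< _ m >]) m mdep).
have indep j : (j < m)%N -> ~ mxiter_dependent T v j.
  by move=> jm jd; have := m_min j (introT (asboolP _) jd); rewrite leqNgt jm.
exists m; last by split; [exact/asboolP|].
by have /krylov_free/eqP <- := indep; exact: rank_leq_col.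
Qed.

(** A right inverse of the row-free Krylov matrix recovers the coefficients from the combination,
    with a bounded loss. *)
Lemma krylov_lower e T v m :
  (forall j, (j < m)%N -> ~ mxiter_dependent T v j) ->
  exists2 C, 1 <= C & forall (b : nat -> Qp) i, (i < m)%N ->
    padic_abs (b i) ^+ e <= C * wnorm e (\sum_(i < m) b i *: mxiter T i v).
Proof.
move=> /krylov_free/row_freeP[B AB].
have [C C1 CP] := wnorm_mulmx e B^T; exists C => // b i im.
apply: le_trans (CP _); set s := \sum_(_ < _) _.
have -> : B^T *m s = (\row_(i < m) b i)^T.
  by rewrite -[s]trmxK -trmx_mul -mul_krylov -mulmxA AB mulmx1.
have := @le_padic_norm _ p_pr _ (\row_(i < m) b i)^T (Ordinal im).
by rewrite !mxE => h; rewrite lerXn2r ?nnegrE ?padic_abs_ge0 ?padic_norm_ge0.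
Qed.

End Iterates.

(** * Exact geometric growth rates *)

Section Growth.
Variables (p : nat) (p_pr : prime p) (n : nat).
Local Notation Qp := (padic p_pr).
Implicit Types (u v : 'cV[Qp]_n) (T : 'M[Qp]_n).
(* The growth rates of the vectors under T are roots of absolute values, of
   orders dividing n!: raising the norm to this power makes them rational. *)
Local Notation e := (n`!).
Local Notation N v := (wnorm e v).

Let e_gt0 : (0 < e)%N := fact_gt0 n.

Lemma sum_scale_delta (m i0 : nat) (f : nat -> 'cV[Qp]_n) : (i0 <= m)%N ->
  \sum_(i < m.+1) (i == i0 :> nat)%:R *: f i = f i0.
Proof.
move=> i0m; rewrite (bigD1 (inord i0)) //= inordK // eqxx scale1r.
rewrite big1 ?addr0 // => i ii0; case: eqP => [E|_]; last by rewrite scale0r.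
by case/eqP: ii0; apply/val_inj; rewrite /= inordK.
Qed.

(** Extreme slope of the Newton polygon: [P] is the e-th power of the largest absolute value of a
    root of X^(m+1) minus the sum of the alpha_i X^i. *)
Lemma dominant_rate m (alpha : nat -> Qp) : (m < n)%N ->
  (exists2 i, (i <= m)%N & alpha i != 0) ->
  exists2 P : rat, 0 < P &
    (forall i, (i <= m)%N -> padic_abs (alpha i) ^+ e * P ^+ i <= P ^+ m.+1) /\
    exists2 i0, (i0 <= m)%N &
      padic_abs (alpha i0) ^+ e * P ^+ i0 = P ^+ m.+1 /\
      forall i, (i < i0)%N -> padic_abs (alpha i) ^+ e * P ^+ i < P ^+ m.+1.
Proof.
move=> mn [l lm al0].
(* The division is exact, as 0 < m + 1 - i <= n. *)
pose F (i : 'I_m.+1) := padic_abs (alpha i) ^+ (e %/ (m.+1 - i)).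
pose P := \big[Num.max/0]_i F i.
have F0 i : 0 <= F i by rewrite exprn_ge0 ?padic_abs_ge0.
have FE (i : 'I_m.+1) : F i ^+ (m.+1 - i) = padic_abs (alpha i) ^+ e.
  rewrite -exprM divnK //; apply: dvdn_fact.
  by rewrite subn_gt0 ltn_ord (leq_trans (leq_subr _ _)).
have P0 : 0 < P.
  apply: lt_le_trans (le_bigmax _ _ (Ordinal (lm : l < m.+1)%N)).
  by rewrite exprn_gt0 // lt_def padic_abs_eq0 al0 padic_abs_ge0.
have Pi i : 0 < P ^+ i by rewrite exprn_gt0.
have PE (i : 'I_m.+1) : P ^+ m.+1 = P ^+ (m.+1 - i) * P ^+ i.
  by rewrite -exprD subnK // ltnW.
have alpha_le i : (i <= m)%N -> padic_abs (alpha i) ^+ e * P ^+ i <= P ^+ m.+1.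
  move=> im; rewrite (PE (Ordinal (im : i < m.+1)%N)) ler_pM2r //.
  rewrite -(FE (Ordinal (im : i < m.+1)%N)) lerXn2r ?nnegrE ?(ltW P0) //.
  exact: le_bigmax.
exists P => //; split => //.
have [j _ jE] := @Order.TotalTheory.eq_bigmax _ rat _ 0 (Ordinal (lm : l < m.+1)%N)
  predT F isT (fun i _ => F0 i).
(* Taking the least index with equality makes the inequality strict below it. *)
pose Q i := (i <= m)%N && (padic_abs (alpha i) ^+ e * P ^+ i == P ^+ m.+1).
have exQ : exists i, Q i.
  exists j; rewrite /Q -ltnS ltn_ord /=; apply/eqP.
  by rewrite -FE (PE j) /P jE.
case: (ex_minnP exQ) => i0 /andP[i0m /eqP eq_i0] i0_min.
exists i0 => //; split => // i ii0.
rewrite lt_neqAle alpha_le ?andbT ?(leq_trans (ltnW ii0)) //.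
apply/negP => eq_i; have := i0_min i; rewrite /Q eq_i andbT.
by rewrite (leq_trans (ltnW ii0)) // leqNgt ii0 => /(_ isT).
Qed.

(** The upper bound is that of the coefficients of T^k v. For the lower bound, [x] is T^i0 v: its
    coefficient vector is dominant and remains so under the companion matrix. *)
Lemma vector_growth T v : T \in unitmx -> v != 0 ->
  exists P x C1 C2, [/\ 0 < P,
    forall k, N (mxiter T k v) <= C1 * P ^+ k &
    forall k, P ^+ k <= C2 * N (mxiter T k x)].
Proof.
move=> Tu v0; have [[|m] mn [[alpha alphaE] indep]] := mxiter_minpoly T v.
  by case/eqP: v0; rewrite -[v]/(mxiter T 0 v) alphaE big_ord0.
have [i im ai0] : exists2 i, (i <= m)%N & alpha i != 0.
  apply: contrapT => alpha0; have /eqP[] : mxiter T m.+1 v != 0.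
    by rewrite mxiter_eq0.
  rewrite alphaE big1 // => i _; case: (eqVneq (alpha i) 0) => [->|ai0].
    by rewrite scale0r.
  by case: alpha0; exists i; rewrite // -ltnS.
have [P P0 [alpha_le [i0 i0m [eq_i0 lt_i0]]]] :=
  dominant_rate mn (ex_intro2 _ _ i im ai0).
have Pi j : 0 < P ^+ j by rewrite exprn_gt0.
pose b (j i : nat) : Qp := (i == j)%:R.
have absb j l : padic_abs (b j l) ^+ e = (l == j)%:R.
  rewrite /b; case: eqP => _; first by rewrite padic_abs1 expr1n.
  exact: padic_absX0.
have iterE j k : (j <= m)%N -> mxiter T k (mxiter T j v) =
    \sum_(i < m.+1) iter k (companion m alpha) (b j) i *: mxiter T i v.
  by move=> jm; rewrite -(mxiter_companion (b j) alphaE) sum_scale_delta.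
have b_le j l : padic_abs (b j l) ^+ e * P ^+ l <= P ^+ j.
  by rewrite absb; case: eqP => [->|_]; rewrite ?mul1r // mul0r ltW.
pose C1 := \big[Num.max/0]_(i < m.+1) (P ^- i * N (mxiter T i v)).
have [C C_ge1 C_P] := krylov_lower e indep.
(* The index l of full weight depends on k; [D] bounds P^l uniformly. *)
pose D := \big[Num.max/0]_(i < m.+1) (P ^+ i).
exists P, (mxiter T i0 v), C1, (C * D / P ^+ i0); split => // k.
  rewrite -[v in mxiter T k v]/(mxiter T 0 v) iterE // wnorm_sum //.
    by rewrite mulr_ge0 ?(ltW (Pi k)) //; exact: bigmax_ge_id.
  move=> j _; rewrite wnormZ.
  have := companion_iter_le e_gt0 P0 alpha_le (fun i _ => b_le 0%N i) k.
  move=> /(_ j); rewrite -ltnS ltn_ord mulr1 -ler_pdivlMr // => /(_ isT) le_j.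
  apply: (@le_trans _ _ (P ^+ k / P ^+ j * N (mxiter T j v))).
    by rewrite ler_wpM2r ?wnorm_ge0.
  rewrite -mulrA mulrC ler_pM2r //; exact: (le_bigmax _ _ j).
have dom0 : companion_dominant e m P i0 (b i0) (P ^+ i0).
  split => [l _|l ll|]; first exact: b_le.
    by rewrite absb ltn_eqF // mul0r.
  by exists i0; rewrite absb eqxx mul1r.
have [_ _ [l [_ lm lE]]] := companion_iter_dominant e_gt0 P0 alpha_le (Pi i0)
  i0m eq_i0 lt_i0 dom0 k.
rewrite mulrAC ler_pdivlMr // -lE iterE // (mulrAC C).
apply: ler_pM; rewrite ?padic_absX_ge0 ?(ltW (Pi l)) ?C_P //.
exact: (le_bigmax _ _ (Ordinal (lm : l < m.+1)%N)).
Qed.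

(** Each basis vector has its own rate. The largest one bounds all the iterates, and its growing
    vector is scaled to norm one. *)
Lemma matrix_growth T : (0 < n)%N -> T \in unitmx ->
  exists P C x, [/\ 0 < P, 1 <= C, padic_norm x = 1,
    forall k v, N (mxiter T k v) <= C * P ^+ k * N v &
    forall k, P ^+ k <= C * N (mxiter T k x)].
Proof.
move=> n_gt0 Tu; pose E (i : 'I_n) : 'cV[Qp]_n := delta_mx i 0.
have E0 i : E i != 0.
  by apply/eqP => /colP/(_ i)/eqP; rewrite !mxE !eqxx oner_eq0.
have /choice[P /choice[x /choice[C1 /choice[C2 H]]]] i := vector_growth Tu (E0 i).
pose j := [arg max_(i > Ordinal n_gt0) P i]%O.
have jmax i : P i <= P j by rewrite /j; case: arg_maxP => // j' _; apply.
have [P0 _ low] := H j.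
have x0 : x j != 0.
  apply/eqP => x0; have := low 0%N.
  by rewrite x0 linear0 wnorm0 // mulr0 expr0 ler10.
pose c := (padic_norm (x j)) ^+ e.
have c0 : 0 < c by rewrite exprn_gt0 ?padic_norm_gt0.
have normx : padic_norm (padic_normalize (x j)) = 1.
  exact: padic_normalize_sphere.
pose D := \big[Num.max/1]_i C1 i.
have D1 : 1 <= D by exact: bigmax_ge_id.
exists (P j), (Num.max D (C2 j * c)), (padic_normalize (x j)).
split => //; first by rewrite le_max D1.
  move=> k v; have vE : v = \sum_i v i 0 *: E i.
    rewrite {1}(matrix_sum_delta v); apply: eq_bigr => i _.
    by rewrite big_ord_recl big_ord0 addr0.
  rewrite {1}vE linear_sum wnorm_sum //.
    by rewrite !mulr_ge0 ?wnorm_ge0 ?exprn_ge0 ?ltW // lt_max (lt_le_trans ltr01).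
  move=> i _; rewrite linearZ wnormZ mulrC ler_pM ?wnorm_ge0 ?padic_absX_ge0 //.
    have [Pi0 up _] := H i; apply: le_trans (up k) _.
    have C1_ge0 : 0 <= C1 i.
      by apply: le_trans (wnorm_ge0 _ _) (_ : N (mxiter T 0 (E i)) <= _);
        rewrite (le_trans (up 0%N)) // expr0 mulr1.
    rewrite ler_pM ?exprn_ge0 ?(ltW Pi0) //.
      by rewrite le_max (le_bigmax _ _ i).
    by rewrite lerXn2r ?nnegrE ?(ltW Pi0) ?(ltW P0).
  by rewrite lerXn2r ?nnegrE ?padic_abs_ge0 ?padic_norm_ge0 // le_padic_norm.
move=> k; apply: le_trans (low k) _.
have -> : N (mxiter T k (x j)) = c * N (mxiter T k (padic_normalize (x j))).
  rewrite [in RHS]linearZ wnormZ padic_abs_ratr_norm // exprVn.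
  by rewrite mulVKf // gt_eqF.
by rewrite mulrA ler_wpM2r ?wnorm_ge0 // le_max lexx orbT.
Qed.

End Growth.

(** * Comparison of close orbits *)

Section Orbits.
Variables (p : nat) (p_pr : prime p) (n : nat) (e : nat).
Hypothesis e_gt0 : (0 < e)%N.
Local Notation Qp := (padic p_pr).
Implicit Types (u v x y a b : 'cV[Qp]_n) (T : 'M[Qp]_n).
Local Notation N v := (wnorm e v).

Definition growth_le T (P C : rat) :=
  forall k v, N (mxiter T k v) <= C * P ^+ k * N v.
Definition growth_ge T (P C : rat) x :=
  forall k, P ^+ k * N x <= C * N (mxiter T k x).

(** Writing v = T^k (T^-k v) turns each bound for T into the opposite bound for its inverse. *)
Lemma growth_inv T P C : T \in unitmx -> 0 < P -> growth_le T P C ->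
  (forall x, growth_ge T P C x) ->
  growth_le (invmx T) P^-1 C /\ forall x, growth_ge (invmx T) P^-1 C x.
Proof.
move=> Tu P0 up low; have TK k : cancel (mxiter (invmx T) k) (mxiter T k).
  by have := @mxiterK _ p_pr n (invmx T) k; rewrite invmxK unitmx_inv; apply.
have Pk k : 0 < P ^+ k by rewrite exprn_gt0.
split=> [k v|v k]; rewrite exprVn.
  rewrite -[v in X in _ <= X](TK k) -(ler_pM2l (Pk k)).
  apply: le_trans (low _ k) _; rewrite TK -(mulrA C) mulrCA mulVKf ?gt_eqF //.
by rewrite -{1}[v](TK k) ler_pdivrMl // mulrA (mulrC _ C) up.
Qed.

(* Compactness of the sphere: a limit of vectors v_j violating the lower
   bound with constant j is a single vector violating all lower bounds. *)
Lemma growth_dichotomy T P C : 0 < P -> 0 < C -> growth_le T P C ->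
  (exists2 C', 0 < C' & forall x, growth_ge T P C' x) \/
  (exists2 w, w != 0 &
    forall eps, 0 < eps -> exists k, N (mxiter T k w) < eps * P ^+ k).
Proof.
move=> P0 C0 up; have [?|nlow] := pselect (exists2 C', 0 < C' &
  forall x, growth_ge T P C' x); [by left | right].
have Pk k : 0 < P ^+ k by rewrite exprn_gt0.
(* A violation of the bound with constant j + 1, rescaled to the sphere. *)
have /choice[v /choice[k vk]] (j : nat) : exists v k,
    padic_norm v = 1 /\ N (mxiter T k v) < j.+1%:R^-1 * P ^+ k.
  apply: contrapT => nv; apply: nlow; exists j.+1%:R; first exact: ltr0Sn.
  move=> x k; rewrite leNgt; apply/negP => lt_x.
  have x0 : x != 0.
    by apply/eqP => x0; move: lt_x; rewrite x0 linear0 wnorm0 // !mulr0 ltxx.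
  apply: nv; exists (padic_normalize x), k; split.
    exact: padic_normalize_sphere.
  rewrite linearZ wnormZ padic_abs_ratr_norm // exprVn -/(wnorm e x).
  rewrite ltr_pdivrMl ?wnorm_gt0 // mulrCA ltr_pdivlMl ?ltr0Sn //.
  by rewrite (mulrC _ (P ^+ k)).
have [G [UG sG]] := ultraFilterLemma eventually_filter.
have v1 j : padic_norm (v j) <= 1 by case: (vk j) => ->.
have [w wlim] := padic_norm_ultra_lim UG v1.
have near r : 0 < r -> G [set j | N (v j - w) < r].
  move=> r0; have r1 : 0 < Num.min 1 r by rewrite lt_min ltr01.
  by apply: filterS (wlim _ r1) => j /=; exact: wnorm_small.
exists w.
  apply/eqP => w0; have [j /=] := filter_ex (near _ ltr01).
  by rewrite w0 subr0 wnorm_lt1 // (vk j).1 ltxx.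
move=> eps eps0; have epsC : 0 < eps / C by rewrite divr_gt0.
have Gj : G [set j | (Num.bound eps^-1 <= j)%N] by apply: sG; exists (Num.bound eps^-1).
have [j [/= jb jw]] := filter_ex (filterI Gj (near _ epsC)).
(* In T^k w = T^k v_j + T^k (w - v_j), the first term is small by the choice of v_j, the second by
   the upper growth bound. *)
exists (k j); rewrite -[w](subrK (v j)) addrC linearD; apply: wnormD_lt => //.
  have [_ lt_v] := vk j; apply: lt_le_trans lt_v _; rewrite ler_pM2r //.
  rewrite invf_ple ?posrE ?ltr0Sn //.
  apply: ltW; apply: lt_le_trans (archi_boundP _) _; first by rewrite invr_ge0 ltW.
  by rewrite ler_nat leqW.
apply: le_lt_trans (up _ _) _; rewrite mulrAC ltr_pM2r //.
by rewrite wnormB -ltr_pdivlMl // mulrC.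
Qed.

Definition affine_map T a x := padic_normalize (a + T *m x).

Section CloseOrbits.
Variables (T : 'M[Qp]_n) (a : 'cV[Qp]_n) (P C : rat).
Hypotheses (P_gt0 : 0 < P) (C_gt0 : 0 < C) (up : growth_le T P C).
Hypothesis a_small : C ^+ 3 * N a < P.
Variables x y : 'cV[Qp]_n.
Hypothesis x1 : N x = 1.
Hypotheses (low : growth_ge T P C x) (xy : C ^+ 2 * N (x - y) < 1).

(** The relative size of the error accumulated from [a]: after k steps it is at most theta P^k,
    below the lower bound P^k / C for N (T^k x) since C theta < 1. *)
Let theta := C ^+ 2 * N a / P.

Let Pk k : 0 < P ^+ k. Proof. by rewrite exprn_gt0. Qed.

Let Tx_gt k r : C * r < P ^+ k -> r < N (mxiter T k x).
Proof.
move=> rk; rewrite -(ltr_pM2l C_gt0) (lt_le_trans rk) //.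
by have := low k; rewrite x1 mulr1.
Qed.

(** Since x and y are close, T^k (x - y) stays below P^k / C, hence below T^k x. *)
Let Txy k : N (mxiter T k y) = N (mxiter T k x).
Proof.
rewrite -[y](subrK x) addrC linearD wnormDl //.
apply: Tx_gt; rewrite -opprB linearN wnormN.
apply: le_lt_trans (_ : C ^+ 2 * N (x - y) * P ^+ k < _).
  by rewrite expr2 -!mulrA ler_pM2l // (mulrC _ (P ^+ k)) mulrA up.
by rewrite gtr_pMl.
Qed.

Let theta_lt : C * theta < 1.
Proof. by rewrite /theta mulrA (mulrA C) -exprS ltr_pdivrMr // mul1r. Qed.

Let Txr k r : N r <= theta * P ^+ k -> N (mxiter T k x + r) = N (mxiter T k x).
Proof.
move=> rk; rewrite wnormDl //; apply: Tx_gt.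
apply: le_lt_trans (_ : C * (theta * P ^+ k) < _); first by rewrite ler_pM2l.
by rewrite mulrA gtr_pMl.
Qed.

(* The k-th iterate of z is s (T^k z + r), with the same scalar s and error
   r for z = x and z = y: the scalars depend only on norms, which agree. *)
Lemma affine_orbits k : exists s r,
  [/\ iter k (affine_map T a) x = s *: (mxiter T k x + r),
      iter k (affine_map T a) y = s *: (mxiter T k y + r),
      padic_abs s ^+ e * N (mxiter T k x) = 1 &
      forall j, N (mxiter T j r) <= theta * P ^+ (j + k)].
Proof.
have theta0 : 0 <= theta.
  by rewrite divr_ge0 ?(ltW P_gt0) // mulr_ge0 ?wnorm_ge0 ?exprn_ge0 ?(ltW C_gt0).
elim: k => [|k [s [r [xE yE sE rE]]]].
  exists 1, 0; split; rewrite ?scale1r ?addr0 // ?padic_abs1 ?expr1n ?mul1r //.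
  by move=> j; rewrite linear0 wnorm0 // mulr_ge0 // ltW.
have s0 : s != 0.
  apply/eqP => s0; move/eqP: sE.
  by rewrite s0 padic_abs0 expr0n gtn_eqF // mul0r eq_sym oner_eq0.
pose r' := T *m r + s^-1 *: a.
have stepE z : a + T *m (s *: (mxiter T k z + r)) = s *: (mxiter T k.+1 z + r').
  rewrite -scalemxAr mulmxDr addrC /r' !scalerDr scalerA divff // scale1r.
  by rewrite addrA.
(* Bounding all T^j r at once keeps C from compounding: T^j (T r) is covered by the hypothesis at j
   + 1. *)
have r'E j : N (mxiter T j r') <= theta * P ^+ (j + k.+1).
  rewrite linearD linearZ /=; apply: wnormD => //.
    by rewrite -[T *m r]/(mxiter T 1 r) mxiterD addnC -addSnnS rE.
  (* The new error term s^-1 a has its scalar measured by N (T^k x), at most C P^k. *)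
  have -> : N (s^-1 *: mxiter T j a) = N (mxiter T k x) * N (mxiter T j a).
    rewrite wnormZ padic_absV exprVn; congr (_ * _).
    by rewrite -[LHS]mulr1 -sE mulKf // expf_eq0 padic_abs_eq0 (negbTE s0) andbF.
  have := ler_pM (wnorm_ge0 _ _) (wnorm_ge0 _ _) (up k x) (up j a).
  rewrite x1 mulr1 => /le_trans; apply; rewrite /theta.
  have -> : P ^+ (j + k.+1) = P * (P ^+ j * P ^+ k) by rewrite addnS exprS exprD.
  by rewrite le_eqVlt; apply/orP; left; apply/eqP; field; rewrite gt_eqF.
have normE : padic_norm (mxiter T k.+1 y + r') = padic_norm (mxiter T k.+1 x + r').
  have r'0 := r'E 0%N.
  apply: (wnorm_inj e_gt0); rewrite Txr // -Txy; apply: wnormDl => //; rewrite Txy.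
  apply: Tx_gt; apply: le_lt_trans (_ : C * (theta * P ^+ k.+1) < _).
    by rewrite ler_pM2l.
  by rewrite mulrA gtr_pMl.
exists (ratr (padic_norm (a + T *m iter k (affine_map T a) x)) * s), r'.
have z0 : mxiter T k.+1 x + r' != 0.
  have := Tx_gt (_ : C * 0 < P ^+ k.+1); rewrite mulr0 => /(_ (Pk _)).
  by rewrite -(Txr (r'E 0%N)) (wnorm_gt0 e_gt0).
split; last exact: r'E.
- by rewrite iterS /affine_map -/(affine_map T a) /padic_normalize xE stepE scalerA.
- rewrite iterS /affine_map -/(affine_map T a) /padic_normalize yE xE !stepE.
  have -> : padic_norm (s *: (mxiter T k.+1 y + r')) =
      padic_norm (s *: (mxiter T k.+1 x + r')).
    by rewrite (padic_normZ s) normE [RHS]padic_normZ.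
  exact: scalerA.
have sz0 : s *: (mxiter T k.+1 x + r') != 0 by rewrite scaler_eq0 negb_or s0.
have as0 : padic_abs s != 0 by rewrite padic_abs_eq0.
have az0 : padic_norm (mxiter T k.+1 x + r') != 0 by rewrite padic_norm_eq0.
rewrite xE stepE padic_absM (padic_abs_ratr_norm sz0) padic_normZ.
have <- : N (mxiter T k.+1 x + r') = N (mxiter T k.+1 x) by exact: Txr (r'E 0%N).
rewrite /wnorm -exprMn invfM.
have E q t : q != 0 -> t != 0 -> q^-1 * t^-1 * q * t = 1 :> rat.
  by move=> q0 t0; field; rewrite q0 t0.
by rewrite (E _ _ as0 az0) expr1n.
Qed.

End CloseOrbits.
End Orbits.

(** * Neighbourhoods in terms of the norm *)

Section Topology.
Variables (p : nat) (p_pr : prime p).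
Local Notation Qp := (padic p_pr).

Lemma padic_nbhsP (x : Qp) (A : set Qp) :
  nbhs x A <-> exists2 eps : rat, 0 < eps & forall y, padic_abs (y - x) < eps -> A y.
Proof.
split=> [/(@nbhs_ballP rat Qp)[eps eps0 epsA]|[eps eps0 epsA]].
  exists eps => //.
  move=> y; rewrite -opprB padic_absN => yx; apply: epsA.
  by rewrite ballEmdist.
apply/(@nbhs_ballP rat Qp); exists eps => //.
by move=> y; rewrite ballEmdist /= => yx; apply: epsA; rewrite -opprB padic_absN.
Qed.

Variable n : nat.
Local Notation V := 'cV[Qp]_n.
Local Notation S := (@padic_sphere p p_pr n).

(** A neighbourhood of a column contains a box of entrywise neighbourhoods, and the least of
    finitely many radii gives a norm ball inside it; norm balls are themselves boxes. *)
Lemma padic_norm_nbhsP (x : V) (A : set V) :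
  nbhs x A <-> exists2 eps, 0 < eps & forall y, padic_norm (y - x) < eps -> A y.
Proof.
split=> [[B xB BA]|[eps eps0 epsA]].
  have /choice[eps epsB] i : exists eps, 0 < eps /\
      forall y, padic_abs (y - x i 0) < eps -> B i 0 y.
    by have /padic_nbhsP[eps eps0 epsB] := xB i 0; exists eps.
  exists (\big[Num.min/1]_i eps i).
    by apply/bigmin_gtP; split => // i _; case: (epsB i).
  move=> y yx; apply: BA => i j; rewrite ord1.
  have [_] := epsB i; apply; have := le_padic_norm (y - x) i.
  rewrite !mxE => /le_lt_trans; apply; apply: lt_le_trans yx _.
  exact: bigmin_le.
exists (fun i j => [set z | padic_abs (z - x i j) < eps]).
  by move=> i j; apply/padic_nbhsP; exists eps.
move=> y /= yx; apply: epsA.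
have [->|/padic_norm_witness[i _ ->]] := eqVneq (y - x) 0.
  by rewrite padic_norm0.
by rewrite !mxE; exact: yx.
Qed.

Lemma padic_sphere_nbhsP (x : S) (A : set S) :
  nbhs x A <->
  exists2 eps, 0 < eps & forall y : S, padic_norm (val y - val x) < eps -> A y.
Proof.
split=> [|[eps eps0 epsA]].
  move=> [_ [[B oB <-] /= Bx BA]].
  have /padic_norm_nbhsP[eps eps0 epsB] : nbhs (val x) B.
    by apply: open_nbhs_nbhs; split.
  by exists eps => // y /epsB By; exact: BA.
have xB : nbhs (val x) [set y : V | padic_norm (y - val x) < eps].
  by apply/padic_norm_nbhsP; exists eps.
have : nbhs x (val @^-1` [set y : V | padic_norm (y - val x) < eps]).
  exact: (@initial_continuous S V val x _ xB).
by apply: filterS => y; exact: epsA.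
Qed.

Lemma padic_sphere1 (x : S) : padic_norm (val x) = 1.
Proof. by have /set_mem := valP x. Qed.

(** * Criteria for distality and for its failure *)

Section Distality.
Variable e : nat.
Hypothesis e_gt0 : (0 < e)%N.
Local Notation N v := (wnorm e v).

(** Restricted to close pairs, the only ones whose orbits [affine_orbits] compares. *)
Definition equicontinuous_iter (K : rat) (phi : S -> S) :=
  forall k x y, K * N (val x - val y) < 1 ->
  N (val (iter k phi x) - val (iter k phi y)) <= K * N (val x - val y).

Lemma equicontinuous_iter_continuous K phi : 0 < K ->
  equicontinuous_iter K phi -> continuous phi.
Proof.
move=> K0 eq_phi x A /padic_sphere_nbhsP[eps eps0 epsA].
pose r := Num.min K^-1 (eps ^+ e / K).
have r0 : 0 < r by rewrite lt_min invr_gt0 K0 divr_gt0 // exprn_gt0.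
apply/padic_sphere_nbhsP; exists (Num.min 1 r) => [|y yx].
  by rewrite lt_min ltr01.
have := wnorm_small e_gt0 yx; rewrite lt_min => /andP[yx1 yx2].
apply: epsA; rewrite (wnorm_lt e_gt0) //.
apply: le_lt_trans (eq_phi 1%N y x _) _; first by rewrite -ltr_pdivlMl ?mulr1.
by rewrite mulrC -ltr_pdivlMr.
Qed.

Lemma iter_cancel (f g : S -> S) k : cancel f g -> cancel (iter k f) (iter k g).
Proof. by move=> fK x; elim: k => // k IHk; rewrite iterSr fK. Qed.

(** If the orbits of x and y came too close, going back as many steps, which expands N at most by K,
    would make x and y closer than they are. *)
Lemma equicontinuous_distal K phi psi : 0 < K -> cancel phi psi ->
  cancel psi phi -> equicontinuous_iter K phi -> equicontinuous_iter K psi ->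
  distal phi.
Proof.
move=> K0 phiK psiK eq_phi eq_psi; exists psi; split=> //.
- exact: equicontinuous_iter_continuous eq_phi.
- exact: equicontinuous_iter_continuous eq_psi.
move=> x y xy; apply/seteqP; split=> // -[d d'] [clos dd'].
have {dd'}E : d = d' := dd'; subst d'.
have xy0 : 0 < N (val x - val y).
  by rewrite (wnorm_gt0 e_gt0) subr_eq0; apply/eqP => /val_inj.
(* The first bound makes equicontinuity applicable, the second makes its conclusion
   contradictory. *)
pose r := Num.min K^-1 (N (val x - val y) / K).
have r0 : 0 < r by rewrite lt_min invr_gt0 K0 divr_gt0.
pose U := [set z : S | N (val z - val d) < r].
have nbhsU : nbhs d U.
  apply/padic_sphere_nbhsP; exists (Num.min 1 r); first by rewrite lt_min ltr01.
  by move=> z; exact: wnorm_small.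
have nbhsUU : nbhs (d, d) (U `*` U) by exists (U, U).
have [[u v] [[k [uE vE]] [/= Uu Uv]]] := clos _ nbhsUU.
have uv : N (val u - val v) < r.
  by rewrite -[val u](subrK (val d)) -addrA wnormD_lt // wnormB.
move: uv; rewrite lt_min => /andP[uv1 uv2].
have {}uv1 : K * N (val u - val v) < 1 by rewrite -ltr_pdivlMl ?mulr1.
have {}uv2 : K * N (val u - val v) < N (val x - val y).
  by rewrite mulrC -ltr_pdivlMr.
suff : N (val x - val y) <= K * N (val u - val v) by rewrite leNgt uv2.
rewrite uE vE /= in uv1 *; case: k {uE vE} uv1 => k /= uv1.
  by have := eq_psi k _ _ uv1; rewrite !(iter_cancel k phiK).
(* [Negz k] stands for k + 1 steps of [psi], undone by k + 1 steps of [phi]. *)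
have := eq_phi k.+1 _ _ uv1.
by rewrite -!iterS !(iter_cancel k.+1 psiK).
Qed.

(* A limit point d of one of the two orbits gives a point (d, d) in the
   closure of the orbit of the pair. *)
Lemma proximal_not_distal phi (x y : S) : x <> y ->
  (forall eps, 0 < eps -> exists k,
    padic_norm (val (iter k phi x) - val (iter k phi y)) < eps) ->
  ~ distal phi.
Proof.
move=> xy prox [psi [_ _ _ _ /(_ x y xy) clos0]].
have /choice[k kP] (j : nat) : exists k,
    padic_norm (val (iter k phi x) - val (iter k phi y)) < j.+1%:R^-1.
  by apply: prox; rewrite invr_gt0 ltr0Sn.
have [G [UG sG]] := ultraFilterLemma eventually_filter.
have x1 j : padic_norm (val (iter (k j) phi x)) <= 1 by rewrite padic_sphere1.
have [d dlim] := padic_norm_ultra_lim UG x1.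
(* By the isosceles principle the limit stays on the sphere. *)
have d1 : padic_norm d = 1.
  have [j /= jd] := filter_ex (dlim 1 ltr01).
  have lt1 : padic_norm (- (val (iter (k j) phi x) - d)) <
      padic_norm (val (iter (k j) phi x)).
    by rewrite padic_normN padic_sphere1.
  by rewrite -[d](subKr (val (iter (k j) phi x))) (padic_normDl lt1) padic_sphere1.
pose D : S := exist _ d (mem_set d1).
suff : closure [set z : S * S | exists k : int,
    z = (iterz phi psi k x, iterz phi psi k y)] `&` diagonal !=set0.
  by rewrite clos0 => -[].
exists (D, D); split=> // B [[U1 U2] /= [/padic_sphere_nbhsP[e1 e10 U1P]]].
move=> /padic_sphere_nbhsP[e2 e20 U2P] UB.
pose r := Num.min e1 e2; have r0 : 0 < r by rewrite lt_min e10.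
have Gj : G [set j | (Num.bound r^-1 <= j)%N] by apply: sG; exists (Num.bound r^-1).
have [j [/= jb jd]] := filter_ex (filterI Gj (dlim _ r0)).
exists (iter (k j) phi x, iter (k j) phi y); split; first by exists (Posz (k j)).
have xy_r : padic_norm (val (iter (k j) phi y) - val (iter (k j) phi x)) < r.
  rewrite -padic_normN opprB; apply: lt_trans (kP j) _.
  rewrite invf_plt ?posrE ?ltr0Sn //.
  apply: lt_le_trans (archi_boundP _) _; first by rewrite invr_ge0 ltW.
  by rewrite ler_nat leqW.
apply: UB; split => /=.
  by apply: U1P; apply: lt_le_trans jd _; rewrite ge_min lexx.
apply: U2P; apply: (@lt_le_trans _ _ r); last by rewrite ge_min lexx orbT.
rewrite -[X in X - _](subrK (val (iter (k j) phi x))) -addrA.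
by apply: le_lt_trans (padic_normD _ _) _; rewrite gt_max xy_r.
Qed.

End Distality.
End Topology.

(** * Distality of the affine sphere maps *)

Section Distal.
Variables (p : nat) (p_pr : prime p) (n : nat) (e : nat).
Hypothesis e_gt0 : (0 < e)%N.
Local Notation Qp := (padic p_pr).
Local Notation V := 'cV[Qp]_n.
Local Notation S := (@padic_sphere p p_pr n).
Implicit Types (u v w x y a b : V) (T : 'M[Qp]_n).
Local Notation N v := (wnorm e v).

(** The norm is an integral power of [p], on which the cast is explicit. *)
Lemma ratr_padic_normV v : v != 0 ->
  ratr (padic_norm v)^-1 = (ratr (padic_norm v))^-1 :> Qp.
Proof.
case/padic_norm_witness => i vi0 ->; case/padic_abs_pow: vi0 => k [] ->.
  by rewrite ratr_powN -(natrX rat) ratr_nat natrX.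
by rewrite invrK ratr_powN invrK -(natrX rat) ratr_nat natrX.
Qed.

Lemma padic_normalizeZ v x : v != 0 -> padic_norm x = 1 ->
  padic_normalize (ratr (padic_norm v) *: x) = x.
Proof.
move=> v0 x1; rewrite /padic_normalize padic_normZ x1 mulr1.
rewrite padic_abs_ratr_norm // ratr_padic_normV // scalerA mulVf ?scale1r //.
by rewrite -padic_abs_eq0 padic_abs_ratr_norm // invr_eq0 padic_norm_eq0.
Qed.

(** The orbits differ by s T^k (x - y); the lower bound gives |s|^e <= C / P^k, and the upper bound
    contributes C P^k. *)
Lemma affine_equicontinuous T a P C : 0 < P -> 0 < C -> growth_le e T P C ->
  (forall x, growth_ge e T P C x) -> C ^+ 3 * N a < P ->
  forall k x y, N x = 1 -> C ^+ 2 * N (x - y) < 1 ->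
  N (iter k (affine_map T a) x - iter k (affine_map T a) y)
    <= C ^+ 2 * N (x - y).
Proof.
move=> P0 C0 up low aP k x y x1 xy.
have [s [r [-> -> s1 _]]] := affine_orbits e_gt0 P0 C0 up aP x1 (low x) xy k.
rewrite -scalerBr opprD addrACA subrr addr0 -linearB wnormZ.
have s0 : 0 <= padic_abs s ^+ e by rewrite padic_absX_ge0.
apply: le_trans (ler_wpM2l s0 (up k (x - y))) _.
rewrite expr2 -!mulrA mulrCA ler_pM2l // mulrA ler_wpM2r ?wnorm_ge0 //.
by have := ler_wpM2l s0 (low x k); rewrite x1 mulr1 mulrCA s1 mulr1.
Qed.

(** If u = c (a + T x) with c a power of [p], then T^-1 u = c (x + T^-1 a). When x + T^-1 a has norm
    one, normalizing removes c. *)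
Definition affine_inv_map T a u := padic_normalize (invmx T *m u) - invmx T *m a.

(* The translation by T^-1 a conjugates the inverse of the map of T and a
   to the map of T^-1 and - T^-2 a. *)
Lemma affine_inv_mapE T a k u : iter k (affine_inv_map T a) u =
  iter k (affine_map (invmx T) (- (invmx T *m (invmx T *m a)))) (u + invmx T *m a)
    - invmx T *m a.
Proof.
elim: k => [|k IHk]; first by rewrite addrK.
rewrite !iterS [in LHS]IHk /affine_inv_map [in RHS]/affine_map.
by congr (padic_normalize _ - _); rewrite mulmxBr addrC.
Qed.

Lemma affine_mapK T a u : T \in unitmx -> padic_norm (invmx T *m a) < 1 ->
  padic_norm u = 1 -> affine_inv_map T a (affine_map T a u) = u.
Proof.
move=> Tu a1 u1.
have n1 : padic_norm (u + invmx T *m a) = 1 by rewrite padic_normDl u1.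
have au0 : a + T *m u != 0.
  apply/eqP => /(congr1 (mulmx (invmx T))); rewrite mulmx0 mulmxDr mulKmx // addrC.
  by move/eqP; rewrite -padic_norm_eq0 n1 oner_eq0.
rewrite /affine_inv_map /affine_map {2}/padic_normalize.
rewrite -scalemxAr mulmxDr mulKmx // [_ + u]addrC padic_normalizeZ //.
by rewrite addrK.
Qed.

Lemma mulmx_unit_neq0 T u : T \in unitmx -> u != 0 -> T *m u != 0.
Proof.
move=> Tu; apply: contraNneq => /(congr1 (mulmx (invmx T))).
by rewrite mulKmx // mulmx0 => ->.
Qed.

Lemma affine_inv_mapK T a u : T \in unitmx -> padic_norm u = 1 ->
  affine_map T a (affine_inv_map T a u) = u.
Proof.
move=> Tu u1; have u0 : u != 0 by rewrite -padic_norm_eq0 u1 oner_eq0.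
rewrite /affine_inv_map /affine_map {2}/padic_normalize.
rewrite mulmxBr mulKVmx // addrC subrK -scalemxAr mulKVmx // padic_normalizeZ //.
by apply: (mulmx_unit_neq0 _ u0); rewrite unitmx_inv.
Qed.

Lemma affine_inv_map_sphere T a (u : S) : T \in unitmx ->
  padic_norm (invmx T *m a) < 1 -> S (affine_inv_map T a (val u)).
Proof.
move=> Tu a1; have u0 : val u != 0 by rewrite -padic_norm_eq0 padic_sphere1 oner_eq0.
have := @padic_normalize_sphere _ p_pr _ (invmx T *m val u).
rewrite /padic_sphere /= /affine_inv_map => w1.
have {}w1 : padic_norm (padic_normalize (invmx T *m val u)) = 1.
  by apply: w1; apply: (mulmx_unit_neq0 _ u0); rewrite unitmx_inv.
by rewrite padic_normDl w1 // padic_normN.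
Qed.

Lemma val_iter_affine T a k (x : S) : T \in unitmx ->
  padic_norm (invmx T *m a) < 1 ->
  val (iter k (affine_sphere_map T a) x) = iter k (affine_map T a) (val x).
Proof.
move=> Tu a1; elim: k => // k IHk.
by rewrite !iterS affine_sphere_mapE // IHk.
Qed.

(** The forward iterates are compared at rate P, the backward ones at rate P^-1 after conjugation by
    a translation; the last smallness condition is for the vector T^-2 a arising there. *)
Lemma affine_sphere_distal T a P C : T \in unitmx -> 0 < P -> 0 < C ->
  growth_le e T P C -> (forall x, growth_ge e T P C x) ->
  padic_norm (invmx T *m a) < 1 -> C ^+ 3 * N a < P ->
  C ^+ 3 * N (invmx T *m (invmx T *m a)) < P^-1 ->
  distal (affine_sphere_map T a).
Proof.
move=> Tu P0 C0 up low a1 aP aP'.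
(* The default [u] is never returned, by [affine_inv_map_sphere]. *)
pose psi (u : S) : S := insubd u (affine_inv_map T a (val u)).
have psiE (u : S) : val (psi u) = affine_inv_map T a (val u).
  by rewrite insubdK //; apply/mem_set/affine_inv_map_sphere.
have S1 (x : S) : N (val x) = 1 by apply/eqP; rewrite wnorm_eq1 // padic_sphere1.
apply: (@equicontinuous_distal _ _ _ _ e_gt0 (C ^+ 2) _ psi).
- by rewrite exprn_gt0.
- move=> x; apply/val_inj; rewrite psiE affine_sphere_mapE //.
  by apply: affine_mapK => //; exact: padic_sphere1.
- move=> u; apply/val_inj; rewrite affine_sphere_mapE // psiE.
  by apply: affine_inv_mapK => //; exact: padic_sphere1.
- move=> k x y xy; rewrite !val_iter_affine //.
  by apply: affine_equicontinuous P0 C0 up low aP _ _ _ _ xy; exact: S1.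
move=> k x y xy; have iterE (u : S) :
    val (iter k psi u) = iter k (affine_inv_map T a) (val u).
  by elim: k {xy} => // k IHk; rewrite !iterS psiE IHk.
rewrite !iterE !affine_inv_mapE opprB addrA subrK.
have [up' low'] := growth_inv Tu P0 up low.
have P'0 : 0 < P^-1 by rewrite invr_gt0.
have b1 : N (invmx T *m a) < N (val x) by rewrite S1 wnorm_lt1.
have subE : val x - val y = (val x + invmx T *m a) - (val y + invmx T *m a).
  by rewrite opprD addrACA subrr addr0.
rewrite subE in xy *.
apply: affine_equicontinuous P'0 C0 up' low' _ _ _ _ _ xy.
  by rewrite wnormN.
by rewrite (wnormDl e_gt0 b1) S1.
Qed.

Lemma distal_near0 T P C : T \in unitmx -> 0 < P -> 0 < C ->
  growth_le e T P C -> (forall x, growth_ge e T P C x) ->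
  exists2 eps, 0 < eps & forall a, padic_norm a < eps ->
    padic_norm (invmx T *m a) < 1 /\ distal (affine_sphere_map T a).
Proof.
move=> Tu P0 C0 up low; have [up' _] := growth_inv Tu P0 up low.
pose D := C / P; have D0 : 0 < D by rewrite divr_gt0.
have invE v : N (invmx T *m v) <= D * N v by exact: (up' 1%N v).
(* The three bounds make a small for T, T^-1 a of norm below one, and T^-2 a small for T^-1. *)
pose r := Num.min (P / C ^+ 3) (Num.min D^-1 (P^-1 / C ^+ 3 / (D * D))).
have r0 : 0 < r by rewrite !lt_min !(divr_gt0, invr_gt0, mulr_gt0, exprn_gt0).
exists (Num.min 1 r) => [|a /(wnorm_small e_gt0)]; first by rewrite lt_min ltr01.
have C30 : 0 < C ^+ 3 by rewrite exprn_gt0.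
rewrite !lt_min => /and3P[a1 a2 a3].
have b1 : padic_norm (invmx T *m a) < 1.
  rewrite -(wnorm_lt1 e_gt0); apply: le_lt_trans (invE a) _.
  by rewrite -ltr_pdivlMl // mulr1.
split=> //; apply: (affine_sphere_distal Tu P0 C0 up low b1).
  by rewrite mulrC -ltr_pdivlMr.
rewrite mulrC -ltr_pdivlMr //.
apply: le_lt_trans (invE _) _; apply: le_lt_trans (ler_wpM2l (ltW D0) (invE a)) _.
by rewrite mulrA mulrC -ltr_pdivlMr // mulr_gt0.
Qed.

(** For a small power d of [p], the k-th iterates of x and x + d w differ by s d T^k w with |s|^e <=
    C / P^k. *)
Lemma affine_sphere_not_distal T a P C x w : T \in unitmx -> 0 < P -> 0 < C ->
  growth_le e T P C -> padic_norm x = 1 -> growth_ge e T P C x ->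
  w != 0 -> (forall eps, 0 < eps -> exists k, N (mxiter T k w) < eps * P ^+ k) ->
  padic_norm (invmx T *m a) < 1 -> C ^+ 3 * N a < P ->
  ~ distal (affine_sphere_map T a).
Proof.
move=> Tu P0 C0 up x1 low w0 ww a1 aP.
(* The outer 1 keeps x + d w on the sphere; the inner minimum has the shape required by
   [wnorm_small]. *)
pose r := Num.min 1 (Num.min 1 (C ^+ 2)^-1).
have C20 : 0 < C ^+ 2 by rewrite exprn_gt0.
have nw0 : 0 < padic_norm w by rewrite padic_norm_gt0.
have r0 : 0 < r by rewrite !lt_min !ltr01 invr_gt0.
have [m mP] := padic_eps p_pr (divr_gt0 r0 nw0).
pose d : Qp := p%:R ^+ m.
have absd : padic_abs d = p%:R ^- m by rewrite padic_absX padic_abs_p exprVn.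
have d0 : 0 < padic_abs d by rewrite absd invr_gt0 exprn_gt0 // ltr0n prime_gt0.
have dw : padic_norm (d *: w) < r by rewrite padic_normZ absd -ltr_pdivlMr.
have dw1 : padic_norm (d *: w) < 1 by rewrite (lt_le_trans dw) // ge_min lexx.
have y1 : padic_norm (x + d *: w) = 1 by rewrite padic_normDl x1.
have Nx1 : N x = 1 by apply/eqP; rewrite wnorm_eq1 ?x1.
have xy : C ^+ 2 * N (x - (x + d *: w)) < 1.
  rewrite opprD addNKr wnormN -ltr_pdivlMl ?mulr1 //.
  by apply: wnorm_small => //; apply: lt_le_trans dw _; rewrite ge_min lexx orbT.
pose X : S := exist _ x (mem_set x1); pose Y : S := exist _ (x + d *: w) (mem_set y1).
apply: (@proximal_not_distal _ _ _ _ X Y).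
  move=> /(congr1 val) /= /eqP; rewrite -subr_eq0 opprD addNKr oppr_eq0 scaler_eq0.
  by rewrite (negbTE w0) orbF -padic_abs_eq0 gt_eqF.
move=> eps eps0; have de0 : 0 < padic_abs d ^+ e by rewrite exprn_gt0.
(* Since |s|^e P^k <= C, this threshold for w brings |s d|^e N (T^k w) below eps^e. *)
have eps'0 : 0 < eps ^+ e / (padic_abs d ^+ e * C).
  by rewrite divr_gt0 ?exprn_gt0 ?mulr_gt0.
have [k kP] := ww _ eps'0; exists k.
rewrite !val_iter_affine //= (wnorm_lt e_gt0) //.
have [s [t [-> -> s1 _]]] := affine_orbits e_gt0 P0 C0 up aP Nx1 low xy k.
rewrite -scalerBr opprD addrACA subrr addr0 -linearB opprD addNKr.
rewrite linearN scalerN wnormN linearZ !wnormZ.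
have s0 : 0 < padic_abs s ^+ e.
  rewrite lt_def padic_absX_ge0 andbT; apply/eqP => sE0.
  by move/eqP: s1; rewrite sE0 mul0r eq_sym oner_eq0.
have sP : padic_abs s ^+ e * P ^+ k <= C.
  by have := ler_wpM2l (ltW s0) (low k); rewrite Nx1 mulr1 mulrCA s1 mulr1.
pose B := eps ^+ e / (padic_abs d ^+ e * C) * P ^+ k.
have lt1 : padic_abs s ^+ e * (padic_abs d ^+ e * N (mxiter T k w)) <
    padic_abs s ^+ e * (padic_abs d ^+ e * B).
  by rewrite !ltr_pM2l.
apply: lt_le_trans lt1 _; rewrite /B.
set q := (X in X <= _).
have -> : q = eps ^+ e * (padic_abs s ^+ e * P ^+ k) / C.
  by rewrite /q; field; rewrite !gt_eqF.
by rewrite ler_pdivrMr // ler_pM2l // exprn_gt0.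
Qed.

End Distal.

Theorem corollary3p3 (p : nat) (p_pr : prime p) (n : nat) (n_gt0 : (0 < n)%N)
    (T : 'M[padic p_pr]_n) (T_unit : T \in unitmx) :
  distal (linear_sphere_map T) <->
  exists V : set 'cV[padic p_pr]_n, nbhs (0 : 'cV[padic p_pr]_n) V /\
    forall a : 'cV[padic p_pr]_n, V a -> a <> 0 ->
      padic_norm (invmx T *m a) < 1 /\ distal (affine_sphere_map T a).
Proof.
move: (n`!) (fact_gt0 n) (matrix_growth n_gt0 T_unit).
move=> e e_gt0 [P [C [x [P0 C1 x1 up low]]]].
have C0 : 0 < C := lt_le_trans ltr01 C1.
have C30 : 0 < C ^+ 3 by rewrite exprn_gt0.
have Nx1 : wnorm e x = 1 by apply/eqP; rewrite wnorm_eq1 ?x1.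
have lowx : growth_ge e T P C x by move=> k; rewrite Nx1 mulr1.
have linE : linear_sphere_map T = affine_sphere_map T 0.
  by apply/funext => u; rewrite /affine_sphere_map add0r.
(* Serves both directions: with a = 0, which is the linear map, and with a small nonzero a. *)
have distal_near a : padic_norm (invmx T *m a) < 1 -> C ^+ 3 * wnorm e a < P ->
    distal (affine_sphere_map T a) -> exists2 eps, 0 < eps &
      forall b, padic_norm b < eps ->
        padic_norm (invmx T *m b) < 1 /\ distal (affine_sphere_map T b).
  move=> a1 aP distal_a.
  have [[C' C'0 lowC']|[w w0 ww]] := growth_dichotomy e_gt0 P0 C0 up; last first.
    by case: (affine_sphere_not_distal e_gt0 T_unit P0 C0 up x1 lowx w0 ww a1 aP).
  (* One constant for both the upper and the lower growth bounds. *)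
  have D0 : 0 < Num.max C C' by rewrite lt_max C0.
  apply: (distal_near0 e_gt0 T_unit P0 D0).
    move=> k v; apply: le_trans (up k v) _.
    rewrite -!mulrA; apply: ler_wpM2r; last by rewrite le_max lexx.
    apply: mulr_ge0; [exact: exprn_ge0 (ltW P0)|exact: wnorm_ge0].
  move=> v k; apply: le_trans (lowC' v k) _.
  by apply: ler_wpM2r; [exact: wnorm_ge0 | rewrite le_max lexx orbT].
rewrite linE; split=> [distal_lin|[V [/padic_norm_nbhsP[eps eps0 epsV] distalV]]].
  have inv0 : padic_norm (invmx T *m 0) < 1 by rewrite mulmx0 padic_norm0 ltr01.
  have small0 : C ^+ 3 * wnorm e (0 : 'cV[padic p_pr]_n) < P.
    by rewrite (wnorm0 p_pr e_gt0) mulr0.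
  have [eps eps0 epsP] := distal_near 0 inv0 small0 distal_lin.
  exists [set a | padic_norm a < eps]; split=> [|a /= /epsP //].
  by apply/padic_norm_nbhsP; exists eps; [exact: eps0 | move=> y; rewrite subr0].
(* A multiple of x by a high power of [p] is nonzero; [eps] puts it in V, and the other bound makes
   C^3 N a < P. *)
pose r := Num.min eps (Num.min 1 (P / C ^+ 3)).
have r0 : 0 < r by rewrite !lt_min eps0 ltr01 (divr_gt0 P0 C30).
have [m mP] := padic_eps p_pr r0.
pose a : 'cV[padic p_pr]_n := (p%:R ^+ m) *: x.
have normA : padic_norm a = p%:R ^- m.
  by rewrite padic_normZ x1 mulr1 padic_absX padic_abs_p exprVn.
have aV : V a.
  by apply: epsV; rewrite subr0 normA; apply: lt_le_trans mP _; rewrite ge_min lexx.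
have a0 : a <> 0.
  apply/eqP; rewrite -padic_norm_eq0 normA; apply: invr_neq0; apply: expf_neq0.
  by rewrite pnatr_eq0 -lt0n (prime_gt0 p_pr).
have [a1 distal_a] := distalV a aV a0.
have aP : C ^+ 3 * wnorm e a < P.
  rewrite mulrC -(ltr_pdivlMr _ _ C30); apply: (wnorm_small e_gt0); rewrite normA.
  by apply: lt_le_trans mP _; rewrite ge_min lexx orbT.
have [eps' eps'0 eps'P] := distal_near a a1 aP distal_a.
by apply: (eps'P 0 _).2; rewrite padic_norm0.
Qed.
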